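(* Let $a\in(-\infty,-1]$ and $f_a(z)=e^z+a$. Then each point of $\mathbb C$ can be separated from $\infty$ by a simple closed (Jordan) curve in $F(f_a)\cup I(f_a)$; that is, for every $z\in\mathbb C$ there is a simple closed curve $\beta\subset F(f_a)\cup I(f_a)$ such that $z$ belongs to the bounded component of $\mathbb C\setminus\beta$.
   Context: For $a\in\mathbb C$ let $f_a:\mathbb C\to\mathbb C$, $f_a(z)=e^z+a$, and let $f_a^n$ denote its $n$-fold iterate. $F(f_a)$ is the Fatou set of $f_a$, and $I(f_a)=\{z\in\mathbb C: f_a^n(z)\to\infty\}$ is the escaping set. A simple closed (Jordan) curve is a homeomorphic image of the circle. *)

(* Defs.v *)
From HB Require Import structures.
From mathcomp Require Import all_boot all_order all_algebra complex.
From mathcomp Require Import all_classical all_reals all_analysis.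

Set Implicit Arguments.
Unset Strict Implicit.
Unset Printing Implicit Defensive.

Import Order.TTheory GRing.Theory Num.Theory.
Import numFieldNormedType.Exports.

Local Open Scope classical_set_scope.
Local Open Scope ring_scope.
Local Open Scope complex_scope.

Section Defs.
Variable R : realType.

(* R[i] itself carries no topology; its regular module R[i]^o is a
   normedModType over R[i], with the usual topology of the plane. *)
Local Notation C := (R[i]^o).

(* [`|z|] lives in R[i]; this is the same number in R. *)
Local Notation modulus z := (Normc.normc (z : R[i])).

Definition cexp (z : C) : C :=
  (expR (complex.Re z))%:C * (cos (complex.Im z) +i* sin (complex.Im z)).

Definition exp_map (a : C) : C -> C := fun z => cexp z + a.

Definition escaping_set (f : C -> C) : set C :=
  [set z | modulus (iter n f z) @[n --> \oo] --> +oo].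

(* The Riemann sphere is [option C], with [None] the point at infinity. *)
Definition chordal (z w : option C) : R :=
  match z, w with
  | Some z, Some w => 2 * modulus (z - w) /
      (Num.sqrt (1 + modulus z ^+ 2) * Num.sqrt (1 + modulus w ^+ 2))
  | Some z, None | None, Some z => 2 / Num.sqrt (1 + modulus z ^+ 2)
  | None, None => 0
  end.

Definition cvg_spherically (U : set C) (g : nat -> C -> C)
    (h : C -> option C) : Prop :=
  forall K : set C, compact K -> K `<=` U ->
  forall e : R, 0 < e ->
  \forall n \near \oo, forall z, K z -> chordal (Some (g n z)) (h z) < e.

(* Montel normality.  The limit function may take the value infinity. *)
Definition normal_family (U : set C) (F : set (C -> C)) : Prop :=
  forall g : nat -> C -> C, (forall n, F (g n)) ->
  exists (phi : nat -> nat) (h : C -> option C),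
    {homo phi : m n / (m < n)%N} /\ cvg_spherically U (g \o phi) h.

Definition iterates (f : C -> C) : set (C -> C) :=
  [set g | exists n, g = iter n f].

Definition fatou_set (f : C -> C) : set C :=
  [set z | exists U : set C, [/\ open U, U z & normal_family U (iterates f)]].

Definition unit_circle : set C := [set z : C | `|z| = 1].

(* [f] restricts to a homeomorphism from the circle onto [b], with inverse
   the restriction of [g]; the values of [f] and [g] elsewhere are junk. *)
Definition simple_closed_curve (b : set C) : Prop :=
  exists f g : C -> C,
    [/\ set_bij unit_circle b f, {in unit_circle, cancel f g},
        {within unit_circle, continuous f} & {within b, continuous g}].

(* [connected_component A z] is empty when [z] is not in [A], hence the
   first conjunct. *)
Definition in_bounded_component (A : set C) (z : C) : Prop :=
  A z /\ bounded_set (connected_component A z).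

End Defs.

(* Main.v *)
(* On the half-plane Re z < 0 the iterates of f = f_a converge uniformly to a
   fixed point, so a point lies in the Fatou set as soon as one of its iterates
   has negative real part.  Choose odd multiples h_n of pi growing like
   h_(n+1) ~ exp(h_n).  The loop beta_n consists of the left half of the circle
   |z - a| = h_n, of two horizontal segments on the lines Im z = +-h_n, which f
   maps into the left half-plane, and of an arc gamma_n crossing
   |Im z| <= h_n at large real part.  The arc satisfies f(gamma_n) = beta_(n+1):
   backward iteration contracts, which gives existence of all the gamma_n at
   once, and forward iteration expands, which gives injectivity.  Hence a point
   of beta_0 either reaches the left half-plane or stays on the arcs gamma_n
   and escapes.
   To see that beta_0 separates the plane without the Jordan curve theorem,
   decide by following the orbit whether a point is inside or outside: both
   sets are open and they are disjoint, and by contraction a point for which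
   no decision is ever reached lies on beta_0. *)
Require Import Defs.
From HB Require Import structures.
From mathcomp Require Import all_boot all_order all_algebra complex.
From mathcomp Require Import all_classical all_reals all_analysis.
From mathcomp Require Import ring lra.

Set Implicit Arguments.
Unset Strict Implicit.
Unset Printing Implicit Defensive.

Import Order.TTheory GRing.Theory Num.Theory.
Import numFieldNormedType.Exports.

Local Open Scope classical_set_scope.
Local Open Scope ring_scope.
Local Open Scope complex_scope.

(** * Real estimates *)

(** Since f - a is the exponential, vertical lines become circles about a. Hence the loops are
    centred at a, and gamma_n stays near the line Re z = ln h_(n+1), whose image is the circle
    carrying the left half of beta_(n+1). While the parameter of gamma_n grows by 2 pi, the image
    runs once around beta_(n+1): where the cosine is negative it follows the half circle and gamma_n
    is exactly vertical, elsewhere it follows the segments and gamma_(n+1). An odd multiple h_n of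
    pi is the centre of a strip of the vertical kind, so the ends of gamma_n are known in advance
    and fit onto the segments at every stage of the construction. The obstacle is that gamma_n is
    defined through gamma_(n+1), with no last level to begin from. Each arc is therefore a uniform
    limit of repeated lifts of vertical lines, and injectivity, which such a limit need not inherit,
    has to be recovered from the dynamics. A second difficulty is a = -1: the attracting point
    becomes the parabolic fixed point 0 on the boundary of the half-plane, and convergence is no
    longer geometric. *)

Section RealEstimates.
Variable R : realType.
Implicit Types (x y t r s A B : R) (m : int).

Lemma sin_MVT x : 0 <= x -> exists2 c, 0 <= c <= x & sin x = cos c * x.
Proof.
move=> x0.
have [c cI E] := MVT_segment x0 (fun z _ => is_derive_sin z)
  (continuous_subspaceT (@continuous_sin R)).
exists c; first by rewrite in_itv /= in cI.
by rewrite sin0 !subr0 in E.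
Qed.

Lemma sin_le x : 0 <= x -> sin x <= x.
Proof.
move=> x0; have [c _ ->] := sin_MVT x0.
by rewrite ler_piMl// cos_le1.
Qed.

Lemma sin_sqr_le x : sin x ^+ 2 <= x ^+ 2.
Proof.
wlog x0 : x / 0 <= x.
  move=> H; have [/H//|/ltW x0] := leP 0 x.
  by rewrite -[sin x ^+ 2]sqrrN -sinN -[x ^+ 2]sqrrN H// oppr_ge0.
have [x1|x1] := leP 1 x.
  have : 1 <= x ^+ 2 by rewrite expr_ge1.
  have := cos2Dsin2 x; have := sqr_ge0 (cos x); lra.
have sx := sin_le x0.
have : 0 <= sin x by rewrite sin_ge0_pi// x0 /=; have := pi_ge2 R; lra.
nra.
Qed.

Lemma pi_lt4 : (pi : R) < 4.
Proof. by have := pihalf_lt2 R; lra. Qed.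

Lemma one_sub_cosE y : 1 - cos y = 2 * sin (y / 2) ^+ 2.
Proof.
have -> : cos y = cos ((y / 2) *+ 2) by congr cos; rewrite mulr2n; field.
by rewrite cos_mulr2n sin2cos2 mulr2n; ring.
Qed.

Lemma one_sub_cos_le y : 2 * (1 - cos y) <= y ^+ 2.
Proof. rewrite one_sub_cosE; have := sin_sqr_le (y / 2); nra. Qed.

(** A crude form of Jordan's inequality. If cos x >= 1/2, the mean value theorem gives x / 2;
    otherwise sin x ^ 2 > 3/4, while x / 4 < 1/2. *)
Lemma sin_lower x : 0 <= x <= pi / 2 -> x / 4 <= sin x.
Proof.
move=> /andP[x0 xpi]; have p2 := pi_ge2 R; have p4 := pi_lt4.
have s0 : 0 <= sin x by rewrite sin_ge0_pi// x0 /=; lra.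
have [c2|c2] := leP (2^-1) (cos x).
  have [c /andP[c0 cx] ->] := sin_MVT x0.
  have : cos x <= cos c.
    have [->//|cNx] := eqVneq c x.
    by rewrite ltW// ltr_cos ?lt_neqAle ?cNx// in_itv/=; lra.
  nra.
have c0 : 0 <= cos x by apply: cos_ge0_pihalf; lra.
have := cos2Dsin2 x; nra.
Qed.

Lemma one_sub_cos_ge y : `|y| <= pi -> y ^+ 2 / 16 <= 2 * (1 - cos y).
Proof.
rewrite -cos_norm -[y ^+ 2]real_normK ?num_real//.
move: (normr_ge0 y); move: `|y| => {}y y0 ypi.
rewrite one_sub_cosE.
have : y / 2 / 4 <= sin (y / 2) by apply: sin_lower; lra.
nra.
Qed.

(** Expansion of the complex exponential, the source of contraction for inverse branches. The law of
    cosines splits the squared distance into a radial and an angular part, each bounded below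
    separately. The factor 1/16 is the loss in comparing 2 (1 - cos u) with u ^ 2 for |u| <= pi. *)
Lemma exp_expand r s x y t : t <= r -> t <= s -> `|x - y| <= pi ->
  expR t ^+ 2 / 16 * ((r - s) ^+ 2 + (x - y) ^+ 2) <=
  (expR r * cos x - expR s * cos y) ^+ 2 +
  (expR r * sin x - expR s * sin y) ^+ 2.
Proof.
move=> tr ts xy.
have -> : (expR r * cos x - expR s * cos y) ^+ 2 +
    (expR r * sin x - expR s * sin y) ^+ 2 =
    (expR r - expR s) ^+ 2 + expR r * expR s * (2 * (1 - cos (x - y))).
  rewrite cosB; have := cos2Dsin2 x; have := cos2Dsin2 y; nra.
have e0 := expR_gt0 t.
have h1 : expR t ^+ 2 * (r - s) ^+ 2 <= (expR r - expR s) ^+ 2.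
  wlog sr : r s tr ts / s <= r.
    move=> H; have [sr|/ltW rs] := leP s r; first exact: H.
    by rewrite -(sqrrN (r - s)) -(sqrrN (expR r - _)) !opprB H.
  have : expR s * (r - s) <= expR r - expR s.
    have -> : expR r = expR s * expR (r - s).
      by rewrite -expRD; congr expR; ring.
    have := expR_ge1Dx (r - s); have := expR_gt0 s; nra.
  have : expR t <= expR s by rewrite ler_expR.
  rewrite -exprMn; move=> H1 H2.
  rewrite ler_pXn2r// ?nnegrE ?mulr_ge0 ?subr_ge0 ?ler_expR// ?expR_ge0//.
  nra.
have h2 : expR t ^+ 2 <= expR r * expR s.
  by rewrite expr2 ler_pM ?expR_ge0 ?ler_expR.
have h3 := one_sub_cos_ge xy.
have h4 := sqr_ge0 (x - y).
have h5 : expR t ^+ 2 * ((x - y) ^+ 2 / 16) <=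
    expR r * expR s * (2 * (1 - cos (x - y))).
  by apply: ler_pM => //; rewrite ?sqr_ge0// divr_ge0.
have := sqr_ge0 (r - s); nra.
Qed.

Lemma cos_2pi_int t m : cos (t - 2 * pi * m%:~R) = cos t.
Proof.
have -> : t - 2 * pi * m%:~R = t + (pi *+ 2) *~ (- m).
  by rewrite -mulrzr mulr2n mulrNz; ring.
case: (- m) => n; first exact: periodicn (@cosD2pi R) _ _.
rewrite NegzE mulrNz -pmulrn.
by rewrite -(periodicn (@cosD2pi R) n.+1) subrK.
Qed.

Lemma sin_2pi_int t m : sin (t - 2 * pi * m%:~R) = sin t.
Proof.
have -> : t - 2 * pi * m%:~R = t + (pi *+ 2) *~ (- m).
  by rewrite -mulrzr mulr2n mulrNz; ring.
case: (- m) => n; first exact: periodicn (@sinD2pi R) _ _.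
rewrite NegzE mulrNz -pmulrn.
by rewrite -(periodicn (@sinD2pi R) n.+1) subrK.
Qed.

Lemma nearest_2pi_int t : exists m, `|t - 2 * pi * m%:~R| <= pi.
Proof.
have p0 := pi_gt0 R.
exists (Num.floor ((t + pi) / (2 * pi))).
have /andP[] := floor_itv ((t + pi) / (2 * pi)).
rewrite intrD ler_pdivlMr ?ltr_pdivrMr; try lra.
by move=> h1 h2; rewrite ler_norml; apply/andP; split; lra.
Qed.

Lemma cos_lt0_strip t m : pi / 2 < `|t - 2 * pi * m%:~R| <= pi -> cos t < 0.
Proof.
rewrite -(cos_2pi_int t m) -cos_norm; move: `|_| => {}t /andP[t1 t2].
rewrite -cos_pihalf ltr_cos// in_itv/=; have := pi_gt0 R; lra.
Qed.

Lemma cos_ge0_strip t m : `|t - 2 * pi * m%:~R| <= pi / 2 -> 0 <= cos t.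
Proof.
by rewrite -(cos_2pi_int t m) ler_norml => /cos_ge0_pihalf.
Qed.

Lemma cos_strip t : cos t < 0 \/
  exists m, `|t - 2 * pi * m%:~R| <= pi / 2.
Proof.
have [m hm] := nearest_2pi_int t.
have [h|h] := leP `|t - 2 * pi * m%:~R| (pi / 2); first by right; exists m.
by left; apply: (@cos_lt0_strip t m); rewrite h.
Qed.

(** [qx] and [qy] are the coordinates of (A + i B) e^(- i t), and the hypothesis keeps this number
    off the closed negative axis. The half-angle formula for its argument uses [atan] alone, which
    makes the branch continuous in all data. *)
Lemma log_exists A B t : 
  0 < Num.sqrt (A ^+ 2 + B ^+ 2) + (A * cos t + B * sin t) ->
  let x := ln (A ^+ 2 + B ^+ 2) / 2 in
  let y := t + 2 * atan ((B * cos t - A * sin t) /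
    (Num.sqrt (A ^+ 2 + B ^+ 2) + (A * cos t + B * sin t))) in
  [/\ expR x * cos y = A, expR x * sin y = B & `|y - t| < pi].
Proof.
set N := Num.sqrt _; set qx := _ + B * _; set qy := B * _ - _ => d0 x y.
have n0 : 0 <= A ^+ 2 + B ^+ 2 by rewrite addr_ge0 ?sqr_ge0.
have N2 : N ^+ 2 = A ^+ 2 + B ^+ 2 by rewrite sqr_sqrtr.
have q2 : qx ^+ 2 + qy ^+ 2 = N ^+ 2.
  rewrite N2 /qx /qy; have := cos2Dsin2 t; nra.
have N0 : 0 < N.
  rewrite lt_neqAle sqrtr_ge0 andbT eq_sym; apply/negP => /eqP N0.
  by move: q2 d0; rewrite N0 => q2 d0; nra.
have ex : expR x = N.
  have : expR x ^+ 2 = N ^+ 2.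
    have -> : expR x ^+ 2 = expR (ln (A ^+ 2 + B ^+ 2)).
      by rewrite expr2 -expRD /x; congr expR; field.
    by rewrite lnK ?N2// posrE -N2 exprn_gt0.
  by move/eqP; rewrite eqrXn2 ?expR_ge0 ?sqrtr_ge0// => /eqP.
set u := qy / (N + qx).
have c0 : 0 < cos (atan u) by rewrite cos_atan invr_gt0 sqrtr_gt0; nra.
have su : sin (atan u) = u * cos (atan u).
  by rewrite -{2}[u]atanK /tan mulfVK// gt_eqF.
have c2 : cos (atan u) ^+ 2 * (1 + u ^+ 2) = 1.
  have := cos2Dsin2 (atan u); rewrite su; nra.
have uE : u * (N + qx) = qy by rewrite /u mulfVK// gt_eqF.
have c2' : cos (atan u) ^+ 2 * (2 * N) = N + qx.
  have e : (1 + u ^+ 2) * (N + qx) = 2 * N.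
    apply: (@mulIf _ (N + qx)); first by rewrite gt_eqF.
    nra.
  by rewrite -e mulrA c2 mul1r.
have cE : N * cos (2 * atan u) = qx.
  by rewrite mulr_natl cos_mulr2n; move: c2'; rewrite mulr2n; lra.
have sE : N * sin (2 * atan u) = qy.
  rewrite mulr_natl sin_mulr2n su; rewrite -uE -c2' mulr2n; ring.
have yE : y = t + 2 * atan u by [].
split.
- rewrite yE cosD ex.
  have -> : N * (cos t * cos (2 * atan u) - sin t * sin (2 * atan u)) =
    cos t * (N * cos (2 * atan u)) - sin t * (N * sin (2 * atan u)) by ring.
  rewrite cE sE -[RHS]mulr1 -(cos2Dsin2 t) /qx /qy; ring.
- rewrite yE sinD ex.
  have -> : N * (sin t * cos (2 * atan u) + cos t * sin (2 * atan u)) =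
    sin t * (N * cos (2 * atan u)) + cos t * (N * sin (2 * atan u)) by ring.
  rewrite cE sE -[RHS]mulr1 -(cos2Dsin2 t) /qx /qy; ring.
- rewrite yE addrC addKr.
  have := atan_gtNpi2 u; have := atan_ltpi2 u.
  move=> h1 h2; rewrite ltr_norml. apply/andP; split; lra.
Qed.

Lemma int_step (j k : int) (c : R) : 2 * pi * j%:~R < 2 * pi * k%:~R + 2 * pi * c ->
  c <= 1 -> j <= k.
Proof.
move=> H c1; have p0 := pi_gt0 R.
have : j%:~R < (k + 1)%:~R :> R.
  rewrite intrD -(ltr_pM2l (x := 2 * pi)); last by lra.
  by apply: lt_le_trans H _; nra.
by rewrite ltr_int ltzD1.
Qed.

Lemma expR2_ge4 : 4 <= expR 2 :> R.
Proof.
have -> : 2 = 1 + 1 :> R by lra.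
by rewrite expRD; have := expR_ge1Dx (1 : R); nra.
Qed.

Lemma odd_pi_multiple (x : R) : exists y, (exists m : int, y = 2 * pi * m%:~R + pi) /\
  x <= y <= x + 2 * pi.
Proof.
have p0 := pi_gt0 R; pose u := (x - pi) / (2 * pi).
have uE : 2 * pi * u = x - pi by rewrite /u mulrC mulfVK// gt_eqF// mulr_gt0.
exists (2 * pi * (Num.floor u + 1)%:~R + pi); split; first by exists (Num.floor u + 1).
have /andP[f1 f2] := floor_itv u.
have := f2; rewrite -(ltr_pM2l (x := 2 * pi)) ?mulr_gt0// uE => g2.
have := f1; rewrite -(ler_pM2l (x := 2 * pi)) ?mulr_gt0// uE => g1.
by move: g1 g2; rewrite intrD => g1 g2; apply/andP; split; lra.
Qed.

End RealEstimates.

(** * Uniform limits and pasting *)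

Section Limits.
Variable R : realType.

Lemma exp2_small (C e : R) : 0 < e -> exists N, C / 2 ^+ N < e.
Proof.
move=> e0; exists (Num.bound (`|C| / e)).
have := @archi_boundP R (`|C| / e) (divr_ge0 (normr_ge0 _) (ltW e0)).
set N := Num.bound _ => h.
have h2 : N%:R <= 2 ^+ N :> R by rewrite -natrX ler_nat ltnW// ltn_expl.
rewrite ltr_pdivrMr ?exprn_gt0//; apply: le_lt_trans (ler_norm C) _.
rewrite mulrC -ltr_pdivrMr//; exact: lt_le_trans h h2.
Qed.

Lemma le_approx (x y C : R) : (forall N, x <= y + C / 2 ^+ N) -> x <= y.
Proof.
move=> h; rewrite leNgt; apply/negP => yx.
have [N hN] : exists N, C / 2 ^+ N < x - y by apply: exp2_small; rewrite subr_gt0.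
by have := h N; lra.
Qed.

(** The functions u_N - 2 C / 2^N increase with N and u_N + 2 C / 2^N decrease, so the supremum of
    the former lies between the two at every stage. This gives the rate, and the rate gives
    continuity. *)
Lemma geometric_limit (u : nat -> R -> R) (C : R) :
  (forall N t, `|u N.+1 t - u N t| <= C / 2 ^+ N) ->
  (forall N, continuous (u N)) ->
  exists2 g : R -> R, continuous g &
    forall N t, `|g t - u N t| <= 2 * C / 2 ^+ N.
Proof.
move=> hu cu.
pose e N : R := 2 * C / 2 ^+ N.
have eS N : e N.+1 = C / 2 ^+ N.
  by rewrite /e exprS invfM; field; rewrite gt_eqF// exprn_gt0.
have eSS N : e N = 2 * (C / 2 ^+ N) by rewrite /e mulrA.
pose v N t := u N t - e N.
pose w N t := u N t + e N.
have vS N t : v N t <= v N.+1 t.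
  rewrite /v eS eSS; have := hu N t; rewrite ler_norml => /andP[]; lra.
have wS N t : w N.+1 t <= w N t.
  rewrite /w eS eSS; have := hu N t; rewrite ler_norml => /andP[]; lra.
have e0 N : 0 <= e N.
  have := hu N 0; have := normr_ge0 (u N.+1 0 - u N 0); rewrite eSS; lra.
have vD N k t : v N t <= v (N + k)%N t.
  by elim: k => [|k IH]; rewrite ?addn0// addnS (le_trans IH).
have wD N k t : w (N + k)%N t <= w N t.
  by elim: k => [|k IH]; rewrite ?addn0// addnS (le_trans _ IH).
have vw N M t : v N t <= w M t.
  apply: le_trans (vD N M t) _; rewrite addnC.
  by apply: le_trans (wD M N t); rewrite /v /w; have := e0 (M + N)%N; lra.
pose g t := sup (range (v^~ t)).
have gP N t : v N t <= g t <= w N t.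
  have ub : ubound (range (v^~ t)) (w N t) by move=> _ [M _ <-]; exact: vw.
  apply/andP; split.
    by apply: ub_le_sup; [exists (w N t)|exists N].
  by apply: ge_sup ub; exists (v 0%N t), 0%N.
have gu N t : `|g t - u N t| <= 2 * C / 2 ^+ N.
  rewrite -/(e N) ler_norml; have := gP N t; rewrite /v /w => /andP[]; lra.
exists g => // t; apply/cvgrPdist_le => d d0.
have [N hN] := @exp2_small (2 * C) (d / 3) (divr_gt0 d0 (ltr0n _ 3)).
have := cu N t; move=> /cvgrPdist_le /(_ (d / 3) (divr_gt0 d0 (ltr0n _ 3))).
apply: filterS => s hs.
have := gu N t; have := gu N s; move: hs hN; rewrite !ler_norml.
by move=> /andP[? ?] ? /andP[? ?] /andP[? ?]; apply/andP; split; lra.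
Qed.

(** Agreement is asked only on [D]: with [D] the unit circle and c = x, the two formulas for a loop
    need to match only at v = 1 and v = -1. *)
Lemma paste_continuous (T : topologicalType) (D : set T) (c f g : T -> R) :
  continuous c -> continuous f -> continuous g ->
  (forall x, D x -> c x = 0 -> f x = g x) ->
  {within D, continuous (fun x => if 0 <= c x then f x else g x)}.
Proof.
move=> cc cf cg fg; apply/subspace_continuousP => x Dx.
apply/cvgrPdist_le => e e0; rewrite near_withinE.
have := cf x; move=> /cvgrPdist_le /(_ e e0) nf.
have := cg x; move=> /cvgrPdist_le /(_ e e0) ng.
have [c0|c0|c0] := ltgtP (c x) 0.
- have nc : \forall y \near x, c y < 0 by apply: cvgr_lt (cc x) _ _.
  apply: filterS2 ng nc => y h cy _.
  by rewrite /from_subspace !(leNgt 0) c0 cy.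
- have nc : \forall y \near x, 0 < c y by apply: cvgr_gt (cc x) _ _.
  apply: filterS2 nf nc => y h cy _.
  by rewrite /from_subspace (ltW c0) (ltW cy).
- have fgx := fg _ Dx c0.
  apply: filterS2 nf ng => y hf hg _.
  rewrite /from_subspace c0 lexx; case: ifP => _; first exact: hf.
  rewrite fgx; exact: hg.
Qed.

Lemma sqr_sum_le (x y C : R) : 0 <= C -> x ^+ 2 + y ^+ 2 <= C ^+ 2 ->
  `|x| <= C /\ `|y| <= C.
Proof.
move=> C0 H; have := sqr_ge0 x; have := sqr_ge0 y => ? ?.
by split; rewrite -(ler_pXn2r (ltn0Sn 1)) ?nnegrE// real_normK ?num_real//; lra.
Qed.

Lemma cvg_approx (u : nat -> R) (g C : R) :
  (forall N, `|g - u N| <= C / 2 ^+ N) -> u @ \oo --> g.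
Proof.
move=> H; apply/cvgrPdist_lt => e e0.
have [N hN] := exp2_small C e0.
exists N => // k /= Nk.
have C0 : 0 <= C.
  by have := le_trans (normr_ge0 _) (H 0%N); rewrite expr0 divr1.
apply: le_lt_trans (H k) _; apply: le_lt_trans hN.
rewrite ler_wpM2l// lef_pV2 ?posrE ?exprn_gt0//.
by rewrite ler_weXn2l// ler1n.
Qed.

Lemma lim_unique (u : nat -> R) (x y : R) :
  u @ \oo --> x -> u @ \oo --> y -> x = y.
Proof. by move=> ux uy; rewrite -(cvg_lim _ ux)// -(cvg_lim _ uy). Qed.

End Limits.

(** * Iteration in the left half-plane *)

(* [exp_map] in real coordinates. *)
Definition exp_step (R : realType) (a : R) (p : R * R) : R * R :=
  (expR p.1 * cos p.2 + a, expR p.1 * sin p.2).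

Section LeftHalfPlane.
Variables (R : realType) (a : R).
Implicit Types (p c e : R) (q : R * R).
Local Notation step := (exp_step a).

(* The recursion says 1 / w_(k+1) >= 1 / w_k + c, whence w_k = O(1 / k). *)
Lemma decay c (w : nat -> R) : 0 < c -> (forall k, 0 <= w k <= 5) ->
  (forall k, w k.+1 <= w k * (1 - c * w k)) ->
  forall k, w k * k.+1%:R <= 5 + 2 / c.
Proof.
move=> c0 w5 ws; have c2 : 0 < 2 / c by rewrite divr_gt0.
elim=> [|k IH]; first by rewrite mulr1; have /andP[_] := w5 0%N; lra.
have /andP[w0 _] := w5 k; have k0 : 0 <= k.+2%:R :> R by rewrite ler0n.
have E : k.+2%:R = k.+1%:R + 1 :> R by rewrite -natr1.
apply: (@le_trans _ _ (w k * (1 - c * w k) * k.+2%:R)); first by rewrite ler_wpM2r.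
have [H|H] := leP (w k * k.+2%:R) (5 + 2 / c).
  apply: le_trans H; rewrite ler_wpM2r// ler_piMr//; nra.
have : 2 <= c * (w k * k.+2%:R).
  have : c * (2 / c) = 2 by rewrite mulrC mulfVK ?gt_eqF.
  move: (2 / c) c2 H => z; nra.
rewrite (_ : w k * (1 - c * w k) * _ = w k * k.+2%:R - w k * (c * (w k * k.+2%:R))); last by ring.
move=> H2; apply: le_trans IH; rewrite E in H2 *; nra.
Qed.

Definition dist2 p q : R := (q.1 - p) ^+ 2 + q.2 ^+ 2.

Lemma dist2_ge0 p q : 0 <= dist2 p q.
Proof. by rewrite addr_ge0 ?sqr_ge0. Qed.

(** The quadratic gain is asked over two steps, since at a = -1 a single step may gain too little.
    [decay] is applied to every second iterate and monotonicity covers the times between. In both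
    applications [T] lies within 2 of p horizontally and within 1 vertically, whence 5 = 2^2 +
    1^2. *)
Lemma uniform_decay p c (T : R * R -> Prop) : 0 < c ->
  (forall q, T q -> T (step q)) ->
  (forall q, T q -> dist2 p q <= 5) ->
  (forall q, T q -> dist2 p (step q) <= dist2 p q) ->
  (forall q, T q -> dist2 p (step (step q)) <= dist2 p q * (1 - c * dist2 p q)) ->
  forall e, 0 < e -> exists N, forall n q, (N <= n)%N -> T q ->
    dist2 p (iter n step q) <= e.
Proof.
move=> c0 TT T5 Tm Ts e e0.
pose C := (5 + 2 / c) / e; pose k := Num.bound C.
have C0 : 0 <= C by rewrite divr_ge0 ?addr_ge0 ?divr_ge0 ?(ltW c0) ?(ltW e0).
have Ck : C < k%:R := archi_boundP C0.
have Tit q n : T q -> T (iter n step q) by move=> Tq; elim: n => //= n /TT.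
exists (k * 2)%N => n q kn Tq.
have mono m : dist2 p (iter (k * 2 + m) step q) <= dist2 p (iter (k * 2) step q).
  elim: m => [|m IH]; first by rewrite addn0.
  by rewrite addnS iterS; apply: le_trans IH; apply: Tm; exact: Tit.
rewrite -(subnKC kn); apply: le_trans (mono _) _.
have H : dist2 p (iter (k * 2) step q) * k.+1%:R <= 5 + 2 / c.
  apply: (@decay c (fun k => dist2 p (iter (k * 2) step q))) => // j.
    by rewrite dist2_ge0 T5//; exact: Tit.
  by rewrite mulSn !addSn add0n !iterS; apply: Ts; exact: Tit.
move: H; rewrite -ler_pdivlMr// => H; apply: le_trans H _.
rewrite ler_pdivrMr// [e * _]mulrC -ler_pdivrMr// -/C; apply: le_trans (ltW Ck) _.
by rewrite ler_nat.
Qed.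

Lemma exp_lipschitz (x y p M : R) : x <= M -> p <= M ->
  (expR x * cos y - expR p) ^+ 2 + (expR x * sin y) ^+ 2 <=
  expR M ^+ 2 * ((x - p) ^+ 2 + y ^+ 2).
Proof.
move=> xM pM.
have -> : (expR x * cos y - expR p) ^+ 2 + (expR x * sin y) ^+ 2 =
    (expR x - expR p) ^+ 2 + expR x * expR p * (2 * (1 - cos y)).
  rewrite -[in LHS](mul1r ((_ * sin y) ^+ 2)) exprMn sin2cos2; ring.
have h1 : (expR x - expR p) ^+ 2 <= expR M ^+ 2 * (x - p) ^+ 2.
  wlog px : x p xM pM / p <= x.
    move=> H; have [px|/ltW xp] := leP p x; first exact: H.
    by rewrite -(sqrrN (x - p)) -(sqrrN (expR x - _)) !opprB H.
  have E : expR p = expR x * expR (p - x) by rewrite -expRD; congr expR; ring.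
  have : expR x <= expR M by rewrite ler_expR.
  have : expR p <= expR x by rewrite ler_expR.
  have := expR_ge1Dx (p - x); have := expR_gt0 x => e1 e2 e3 e4.
  rewrite -exprMn ler_pXn2r// ?nnegrE ?subr_ge0// ?mulr_ge0 ?subr_ge0 ?expR_ge0//.
  by rewrite E; nra.
have h2 : expR x * expR p <= expR M ^+ 2 by rewrite expr2 ler_pM ?expR_ge0 ?ler_expR.
have h3 := one_sub_cos_le y.
have h4 : expR x * expR p * (2 * (1 - cos y)) <= expR M ^+ 2 * y ^+ 2.
  by apply: ler_pM => //; rewrite ?mulr_ge0 ?expR_ge0// subr_ge0 cos_le1.
lra.
Qed.

Lemma step_left q : a <= -1 -> q.1 < 0 ->
  [/\ a - 1 <= (step q).1, (step q).1 < a + 1 & `|(step q).2| <= 1].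
Proof.
move=> ha q0; rewrite /exp_step /=; have e0 := expR_gt0 q.1.
have e1 : expR q.1 < 1 by rewrite expR_lt1.
have := cos_geN1 q.2; have := cos_le1 q.2; have := sin_geN1 q.2; have := sin_le1 q.2.
move=> s1 s2 c1 c2; split; [nra|nra|rewrite ler_norml; apply/andP; split; nra].
Qed.

Lemma attracting_case : a < -1 ->
  exists p, forall e, 0 < e -> exists N, forall n q, (N <= n)%N -> q.1 < 0 ->
    dist2 p (iter n step q) <= e.
Proof.
move=> ha.
have [p pI Ep] : exists2 p, p \in `[a, 0]%R & expR p - p = - a.
  apply: (@IVT R (fun x => expR x - x)); first lra.
    apply: continuous_subspaceT => x; apply: cvgB; [exact: continuous_expR|exact: cvg_id].
  have := expR_gt0 a; rewrite expR0 => ea.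
  by rewrite ge_min le_max; apply/andP; split; apply/orP; [right|left]; lra.
have /andP[p1 p2] : a <= p <= 0 by rewrite in_itv in pI.
have p3 : p <= a + 1 by have : expR p <= 1; [rewrite expR_le1|lra].
exists p.
(* One step sends the left half-plane into Re z < a + 1, where |f'| < e^(a + 1) < 1; the fixed point
   satisfies p <= a + 1 as well. *)
pose M := a + 1; pose K := expR M ^+ 2.
have M0 : M < 0 by rewrite /M; lra.
have K0 : 0 < K by rewrite exprn_gt0// expR_gt0.
have K1 : K < 1 by rewrite /K expr_lt1// ?expR_ge0// expR_lt1.
pose T q := [/\ a - 1 <= q.1, q.1 < a + 1 & `|q.2| <= 1].
have contr q : T q -> dist2 p (step q) <= K * dist2 p q.
  move=> [_ q1 _]; have := exp_lipschitz q.2 (ltW q1) p3.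
  rewrite /dist2 /exp_step /=.
  by rewrite (_ : expR q.1 * cos q.2 + a - p = expR q.1 * cos q.2 - expR p)//; lra.
have T5 q : T q -> dist2 p q <= 5.
  move=> [q1 q2]; rewrite ler_norml /dist2 => /andP[q3 q4]; nra.
have TT q : T q -> T (step q) by move=> [_ q1 _]; apply: step_left; lra.
(* Linear contraction by K implies the quadratic form, because V <= 5 gives (1 - K) V >= ((1 - K) /
   5) V^2. *)
have H := @uniform_decay p ((1 - K) / 5) T _ TT T5 _ _.
move=> e e0; have [||| N HN] := H _ _ _ e e0.
- by rewrite divr_gt0// subr_gt0.
- by move=> q Tq; have := contr q Tq; have := dist2_ge0 p q; nra.
- move=> q Tq; have := contr q Tq; have := contr _ (TT _ Tq).
  have := dist2_ge0 p q; have := T5 q Tq.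
  move: (dist2 p q) (dist2 p (step q)) (dist2 p (step (step q))) => V V' V'' V5 V0 W W'.
  have V'V : V' <= V by nra.
  have VV : V'' <= K * V by apply: le_trans W _; rewrite ler_wpM2l// ltW.
  have : (1 - K) * V * V <= (1 - K) * V * 5 by rewrite ler_wpM2l// mulr_ge0//; lra.
  lra.
exists N.+1 => -[//|n] q Nn q0; rewrite iterSr; apply: HN => //.
by apply: step_left q0; exact: ltW.
Qed.

End LeftHalfPlane.

(** * The parabolic parameter a = -1 *)

Section Parabolic.
Variable R : realType.
Local Notation step := (@exp_step R (-1)).

Definition trap (q : R * R) := [/\ -2 <= q.1, q.1 < 0 & `|q.2| <= 1].

Lemma trap_step q : trap q -> trap (step q).
Proof.
move=> [_ q0 _]; have [H1 H2 H3] := step_left (lexx (-1)) q0.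
by split=> //; move: H1 H2; lra.
Qed.

(** The fixed point 0 has multiplier 1, so the factor has to tend to 1 as Re q tends to 0. With x =
    Re q in [-2, 0], both e^x <= 1 + x / 4 and 1 - e^x <= - x (1 + x / 4) hold; the second comes
    from e^x >= (1 + x / 2)^2, which uses x >= -2. *)
Lemma trap_contract q : trap q -> dist2 0 (step q) <= (1 + q.1 / 4) * dist2 0 q.
Proof.
move=> [q1 q2 _]; rewrite /dist2 /exp_step /= !subr0.
have E : (expR q.1 * cos q.2 - 1) ^+ 2 + (expR q.1 * sin q.2) ^+ 2 =
    (1 - expR q.1) ^+ 2 + expR q.1 * (2 * (1 - cos q.2)).
  rewrite -[in LHS](mul1r ((_ * sin _) ^+ 2)) exprMn sin2cos2; ring.
rewrite E.
have e0 := expR_gt0 q.1; have c0 := one_sub_cos_le q.2.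
have c1 := cos_le1 q.2; have y0 := sqr_ge0 q.2.
have u1 : expR q.1 <= 1 + q.1 / 4.
  have := expR_ge1Dx (- q.1); have := expRxMexpNx_1 q.1.
  move: (expR (- q.1)) => f; nra.
have u2 : 1 - expR q.1 <= - q.1 * (1 + q.1 / 4).
  have -> : expR q.1 = expR (q.1 / 2) ^+ 2.
    by rewrite expr2 -expRD; congr expR; field.
  have := expR_ge1Dx (q.1 / 2); have := expR_gt0 (q.1 / 2); nra.
have u0 : 0 <= 1 - expR q.1 by rewrite subr_ge0 expR_le1 ltW.
move: (expR q.1) e0 u1 u2 u0 => f e0 u1 u2 u0.
have v1 : (1 - f) ^+ 2 <= (- q.1 * (1 + q.1 / 4)) ^+ 2 by rewrite ler_pXn2r ?nnegrE//; nra.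
have v2 : f * (2 * (1 - cos q.2)) <= (1 + q.1 / 4) * q.2 ^+ 2 by apply: ler_pM => //; lra.
have v3 : (- q.1 * (1 + q.1 / 4)) ^+ 2 <= (1 + q.1 / 4) * q.1 ^+ 2.
  by rewrite exprMn sqrrN mulrC; apply: ler_wpM2r; [exact: sqr_ge0|nra].
lra.
Qed.

(* [trap_contract] is void near the imaginary axis; there the first step moves
   the point to the left, so that the second one contracts. *)
Lemma trap_drift q : trap q -> q.2 ^+ 2 / 32 <= - (step q).1.
Proof.
move=> [q1 q2 q3]; rewrite /exp_step /=; have p2 := pi_ge2 R.
have := one_sub_cos_ge (le_trans q3 (le_trans (ler1n _ 2) p2)).
have e0 := expR_gt0 q.1; have e1 : expR q.1 < 1 by rewrite expR_lt1.
have : q.2 ^+ 2 <= 1 by rewrite -(real_normK (num_real q.2)) expr_le1.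
have := cos_le1 q.2; have := cos_geN1 q.2.
move=> c1 c2 y1 c3; have [cp|cn] := leP 0 (cos q.2); nra.
Qed.

Lemma parabolic_case (e : R) : 0 < e -> exists N, forall n (q : R * R),
  (N <= n)%N -> q.1 < 0 -> dist2 0 (iter n step q) <= e.
Proof.
move=> e0.
(* With x = Re q, s = Re f(q) and V = |q|^2, two steps contract by (1 + s / 4) (1 + x / 4) <= 1 + (s
   + x) / 8, and V / 32 <= - x - s by [trap_drift]; hence 256 = 8 . 32. *)
have [||||| N HN] := @uniform_decay R (-1) 0 (1 / 256) trap _ _ _ _ _ e e0.
- lra.
- exact: trap_step.
- by move=> q [q1 q2]; rewrite ler_norml /dist2 subr0 => /andP[q3 q4]; nra.
- move=> q Tq; apply: le_trans (trap_contract Tq) _.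
  by rewrite ler_piMl ?dist2_ge0//; case: Tq; lra.
- move=> q Tq; apply: le_trans (trap_contract (trap_step Tq)) _.
  have := trap_contract Tq; have := trap_drift Tq; have := dist2_ge0 0 (step q).
  have := dist2_ge0 0 q; have [s1 s2 _] := trap_step Tq; have [q1 q2 q3] := Tq.
  have E : dist2 0 q = q.1 ^+ 2 + q.2 ^+ 2 by rewrite /dist2 subr0.
  move: (dist2 0 (step q)) (dist2 0 q) (step q).1 E s1 s2 => V' V s E s1 s2 V0 V'0 dr ct.
  have k1 : V / 32 <= - q.1 - s by nra.
  have k2 : (1 + s / 4) * V' <= (1 + s / 4) * ((1 + q.1 / 4) * V) by apply: ler_wpM2l => //; lra.
  apply: le_trans k2 _.
  rewrite mulrA mulrC; apply: ler_wpM2l => //.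
  have : s * q.1 <= - 2 * (s + q.1) by nra.
  nra.
exists N.+1 => -[//|n] q Nn q0; rewrite iterSr; apply: HN => //.
by have [H1 H2 H3] := step_left (lexx (-1)) q0; split=> //; move: H1 H2; lra.
Qed.

End Parabolic.

Lemma left_half_plane_cvg (R : realType) (a : R) : a <= -1 ->
  exists p : R, forall e, 0 < e -> exists N, forall n q, (N <= n)%N -> q.1 < 0 ->
    dist2 p (iter n (exp_step a) q) <= e.
Proof.
rewrite le_eqVlt => /orP[/eqP ->|]; last exact: attracting_case.
by exists 0; exact: parabolic_case.
Qed.

(** * Topology and dynamics on the plane *)

Section Plane.
Variable R : realType.
Local Notation C := (R[i]^o).
Local Notation modulus z := (Normc.normc (z : R[i])).

Definition pt (p : R * R) : C := p.1 +i* p.2.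
Definition coord (z : C) : R * R := (complex.Re z, complex.Im z).

Lemma coordK : cancel coord pt. Proof. by case. Qed.
Lemma ptK : cancel pt coord. Proof. by case. Qed.

Lemma modulusE (z : C) : modulus z = Num.sqrt (complex.Re z ^+ 2 + complex.Im z ^+ 2).
Proof. by case: z. Qed.

Lemma norm_lt (z : C) (e : R) : 0 < e -> (`|z| < e%:C) =
  (complex.Re z ^+ 2 + complex.Im z ^+ 2 < e ^+ 2).
Proof.
move=> e0; rewrite (normc_def z) ltcR -[in LHS](gtr0_norm e0) -sqrtr_sqr ltr_sqrt//.
by rewrite exprn_gt0.
Qed.

Lemma ReB (z w : C) : complex.Re (z - w) = complex.Re z - complex.Re w.
Proof. by case: z; case: w. Qed.
Lemma ImB (z w : C) : complex.Im (z - w) = complex.Im z - complex.Im w.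
Proof. by case: z; case: w. Qed.

(** The norm takes values in [R[i]], so balls have radii in [R[i]], and positivity there forces a
    radius to be real. Passing to boxes with real sides reduces continuity to coordinates. *)
Lemma nbhs_box (z : C) (A : set C) : nbhs z A <->
  exists2 e : R, 0 < e & forall w : C,
    `|complex.Re w - complex.Re z| < e -> `|complex.Im w - complex.Im z| < e -> A w.
Proof.
split.
  move=> /(@nbhs_normP R[i] C z A)[e /= e0 H].
  have [r r0 eE] : exists2 r : R, 0 < r & e = r%:C.
    move: e e0 {H} => [x y]; rewrite ltcE /= => /andP[/eqP -> x0].
    by exists x.
  exists (r / 2) => [|w h1 h2]; first by rewrite divr_gt0.
  apply: H; rewrite eE /= norm_lt// ReB ImB.
  have sq (x : R) : `|x| < r / 2 -> (- x) ^+ 2 < (r / 2) ^+ 2.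
    move=> hx; rewrite sqrrN -(real_normK (num_real x)).
    by rewrite ltr_pXn2r ?nnegrE ?divr_ge0 ?(ltW r0)//.
  have := sq _ h1; have := sq _ h2; rewrite !opprB; nra.
move=> [e e0 H]; apply/(@nbhs_normP R[i] C z A); exists e%:C => /=; first by rewrite ltcR.
move=> w; rewrite /= norm_lt// ReB ImB => hw.
have sq (x : R) : x ^+ 2 < e ^+ 2 -> `|x| < e.
  by rewrite -(real_normK (num_real x)) ltr_pXn2r ?nnegrE// ltW.
have h1 := sqr_ge0 (complex.Re z - complex.Re w).
have h2 := sqr_ge0 (complex.Im z - complex.Im w).
by apply: H; rewrite distrC; apply: sq; lra.
Qed.

Lemma cvg_pt (T : Type) (F : set_system T) {FF : Filter F} (f g : T -> R) (z : C) :
  f @ F --> complex.Re z -> g @ F --> complex.Im z ->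
  (fun t => pt (f t, g t)) @ F --> z.
Proof.
move=> /cvgrPdist_lt fz /cvgrPdist_lt gz A /nbhs_box[e e0 H].
change (F [set t | A (pt (f t, g t))]).
move: (fz e e0) (gz e e0); apply: filterS2 => t h1 h2.
by apply: H; rewrite distrC.
Qed.

Lemma continuous_Re : continuous (@complex.Re R : C -> R).
Proof.
move=> z; have : complex.Re w @[w --> z] --> complex.Re z; last exact.
apply/(@cvgrPdist_lt _ _ _ _ (@nbhs_filter C z)) => e e0; apply/nbhs_box; exists e => // w h1 _.
by rewrite distrC.
Qed.

Lemma continuous_Im : continuous (@complex.Im R : C -> R).
Proof.
move=> z; have : complex.Im w @[w --> z] --> complex.Im z; last exact.
apply/(@cvgrPdist_lt _ _ _ _ (@nbhs_filter C z)) => e e0; apply/nbhs_box; exists e => // w _ h1.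
by rewrite distrC.
Qed.

Lemma unit_circleE (z : C) :
  unit_circle z <-> complex.Re z ^+ 2 + complex.Im z ^+ 2 = 1.
Proof.
rewrite /unit_circle /= (normc_def z); split=> [/complexI /(congr1 (fun x => x ^+ 2))|->].
  by rewrite sqr_sqrtr ?expr1n// addr_ge0 ?sqr_ge0.
by rewrite sqrtr1.
Qed.

Lemma compact_unit_circle : compact (@unit_circle R).
Proof.
have -> : @unit_circle R = (fun t : R => pt (cos t, sin t)) @` `[- pi, pi].
  apply/seteqP; split => [z /unit_circleE|_ [t _ <-]]; last first.
    by apply/unit_circleE; rewrite /= cos2Dsin2.
  move: z => [x y] /= xy.
  have x1 : -1 <= x <= 1 by apply/andP; split; nra.
  have xI : x \in `[-1, 1]%R by rewrite in_itv.
  have a0 := acos_ge0 x1; have a1 := acos_lepi x1; have p0 := pi_ge0 R.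
  have sE := sin_acos x1.
  have [y0|y0] := leP 0 y.
    exists (acos x); first by rewrite /= in_itv/=; apply/andP; split; lra.
    rewrite /pt /= acosK// sE (_ : 1 - x ^+ 2 = y ^+ 2) ?sqrtr_sqr ?ger0_norm//; lra.
  exists (- acos x); first by rewrite /= in_itv/=; apply/andP; split; lra.
  rewrite /pt /= cosN sinN acosK// sE (_ : 1 - x ^+ 2 = y ^+ 2) ?sqrtr_sqr ?ltr0_norm ?opprK//; lra.
apply: continuous_compact; last exact: segment_compact.
apply: continuous_subspaceT => t.
by apply: cvg_pt; [exact: continuous_cos|exact: continuous_sin].
Qed.

Lemma continuous_inverse_compact (T U : topologicalType) (A : set T)
    (f : T -> U) (g : U -> T) : hausdorff_space U -> compact A ->
  {within A, continuous f} -> {in A, cancel f g} ->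
  {within f @` A, continuous g}.
Proof.
move=> hU cA cf fg; apply/continuous_closedP => W cW; apply/closed_subspaceP.
exists (f @` (A `&` W)).
  apply: compact_closed => //; apply: continuous_compact.
    by apply: continuous_subspaceW cf; exact: subIsetl.
  exact: compact_closedI.
apply/seteqP; split=> [y [[x [Ax Wx] <-] Afx]|y [Wy [x Ax xy]]].
  by split=> //; change (W (g (f x))); rewrite fg ?inE.
split; last by exists x.
exists x => //; split=> //; move: Wy; change (W (g y) -> W x).
by rewrite -xy fg ?inE.
Qed.

Section Dynamics.
Variable a : R.
Local Notation f := (exp_map (a%:C : C)).

Lemma exp_map_pt p : f (pt p) = pt (exp_step a p).
Proof.
case: p => x y; rewrite /exp_map /cexp /pt /exp_step /=; apply/eqP.
rewrite eq_complex /=; apply/andP; split; apply/eqP; ring.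
Qed.

Lemma exp_mapE z : f z = pt (exp_step a (coord z)).
Proof. by rewrite -exp_map_pt coordK. Qed.

Lemma iter_exp_map n z : iter n f z = pt (iter n (exp_step a) (coord z)).
Proof.
elim: n => [|n IH]; first by rewrite coordK.
by rewrite !iterS IH exp_map_pt.
Qed.

Lemma exp_map_continuous : continuous f.
Proof.
move=> z; have FF : Filter (nbhs z) := @nbhs_filter C z.
rewrite (_ : f = fun w => pt (expR (complex.Re w) * cos (complex.Im w) + a,
  expR (complex.Re w) * sin (complex.Im w))); last first.
  by apply/funext => w; rewrite exp_mapE.
have cR : complex.Re w @[w --> z] --> complex.Re z := @continuous_Re z.
have cI : complex.Im w @[w --> z] --> complex.Im z := @continuous_Im z.
have cE : expR (complex.Re w) @[w --> z] --> expR (complex.Re z).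
  by apply: continuous_cvg cR; exact: continuous_expR.
apply: cvg_pt.
  apply: cvgD; last exact: cvg_cst.
  by apply: cvgM => //; apply: continuous_cvg cI; exact: continuous_cos.
by apply: cvgM => //; apply: continuous_cvg cI; exact: continuous_sin.
Qed.

Lemma iter_exp_map_continuous n : continuous (iter n f).
Proof.
elim: n => [|n IH] z; first exact: cvg_id.
by apply: continuous_comp; [exact: IH|exact: exp_map_continuous].
Qed.

Lemma chordal_le (z w : C) : chordal (Some z) (Some w) <= 2 * modulus (z - w).
Proof.
rewrite /chordal.
have m0 (u : C) : 0 <= modulus u by rewrite modulusE sqrtr_ge0.
have s1 (u : C) : 1 <= Num.sqrt (1 + modulus u ^+ 2).
  by rewrite -[leLHS]sqrtr1 ler_wsqrtr// lerDl sqr_ge0.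
rewrite ler_pdivrMr; last by rewrite mulr_gt0// (lt_le_trans ltr01).
by rewrite ler_peMr ?mulr_ge0// mulr_ege1.
Qed.

Lemma chordal_refl (z : C) : chordal (Some z) (Some z) = 0.
Proof. by rewrite /chordal subrr Normc.normc0 mulr0 mul0r. Qed.

End Dynamics.

(** * Criteria for Fatou points and escaping points *)

Lemma subsequence (P : nat -> nat -> Prop) :
  (forall m M, exists n, (M <= n)%N /\ P m n) ->
  exists phi, {homo phi : m n / (m < n)%N} /\ forall m, P m (phi m).
Proof.
move=> H.
have [c Hc] := choice (fun mM : nat * nat => H mM.1 mM.2).
pose phi := fix phi m := if m is m'.+1 then c (m, (phi m').+1) else c (0%N, 0%N).
exists phi; split; last by case=> [|m]; exact: (Hc (_, _)).2.
apply: homo_ltn => [y x z|i]; first exact: ltn_trans.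
exact: (Hc (i.+1, (phi i).+1)).1.
Qed.

Lemma infinitely_repeated (j : nat -> nat) N M :
  (forall n, (M <= n)%N -> (j n < N)%N) ->
  exists v, forall M', exists n, (M' <= n)%N /\ j n = v.
Proof.
elim: N M => [|N IH] M H; first by have := H M (leqnn M).
have [?|] := pselect (forall M', exists n, (M' <= n)%N /\ j n = N); first by exists N.
move=> /existsNP[M' HM']; apply: (IH (maxn M M')) => n.
rewrite geq_max => /andP[h1 h2]; have := H n h1; rewrite ltnS leq_eqVlt.
by case/orP => // /eqP E; exfalso; apply: HM'; exists n.
Qed.

(** Normality holds on the open set where f^k has negative real part. In a sequence of iterates f^(j
    n), either j is unbounded and a subsequence tends uniformly to the fixed point, or j repeats one
    value infinitely often and a subsequence is constant. *)
Lemma fatou_left (a : R) (p : R * R) k : a <= -1 ->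
  (iter k (exp_step a) p).1 < 0 -> fatou_set (exp_map (a%:C : C)) (pt p).
Proof.
move=> ha pk; set f := exp_map _.
pose U : set C := [set z | complex.Re (iter k f z) < 0].
have UE z : U z -> (iter k (exp_step a) (coord z)).1 < 0.
  by rewrite /U /= iter_exp_map.
exists U; split.
- rewrite (_ : U = (fun z => complex.Re (iter k f z)) @^-1` [set x | x < 0])//.
  apply: open_comp; last exact: open_lt.
  move=> z _; apply: continuous_comp; last exact: continuous_Re.
  exact: iter_exp_map_continuous.
- by rewrite /U /= iter_exp_map ptK.
move=> g Hg; have [j Hj] := choice Hg.
have [fx Hfx] := left_half_plane_cvg ha.
have [unb|bnd] := pselect (forall N M, exists n, (M <= n)%N /\ (N <= j n)%N).
  have [phi [mono Hphi]] := subsequence unb.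
  exists phi, (fun=> Some (fx%:C)); split=> // K _ KU e e0.
  (* [dist2] is a squared distance and the chordal distance is at most twice the Euclidean one, so
     this leaves e / 2. *)
  have [N HN] := Hfx _ (exprn_gt0 2 (divr_gt0 e0 (ltr0n _ 4))).
  exists (N + k)%N => // n /= Nn z Kz.
  have Nj : (N + k <= j (phi n))%N := leq_trans Nn (Hphi n).
  have kj : (k <= j (phi n))%N := leq_trans (leq_addl _ _) Nj.
  have jn : (N <= j (phi n) - k)%N by rewrite leq_subRL// addnC.
  apply: le_lt_trans (chordal_le _ _) _; rewrite Hj.
  rewrite iter_exp_map -(subnK kj) iterD.
  have := HN _ _ jn (UE _ (KU _ Kz)); set q := iter _ _ (iter _ _ _).
  rewrite /dist2 => H; rewrite modulusE ReB ImB /= subr0.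
  have : Num.sqrt ((q.1 - fx) ^+ 2 + q.2 ^+ 2) <= e / 4.
    rewrite -[leRHS]ger0_norm ?divr_ge0 ?(ltW e0)// -sqrtr_sqr.
    exact: ler_wsqrtr.
  lra.
have [v Hv] : exists v, forall M', exists n, (M' <= n)%N /\ j n = v.
  move: bnd => /existsNP[N /existsNP[M H]]; apply: (@infinitely_repeated j N M) => n Mn.
  by rewrite ltnNge; apply/negP => Nj; apply: H; exists n.
have [phi [mono Hphi]] := subsequence (fun _ => Hv).
exists phi, (fun z => Some (iter v f z)); split=> // K _ _ e e0.
exists 0%N => // n _ z _.
by rewrite (_ : (g \o phi) n z = iter v f z) ?chordal_refl//= Hj Hphi.
Qed.

Lemma escaping_of_Re (a : R) (p : R * R) (h : nat -> R) :
  (forall n, n%:R <= h n) -> (forall n, h n <= (iter n (exp_step a) p).1) ->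
  escaping_set (exp_map (a%:C : C)) (pt p).
Proof.
move=> hn ph; rewrite /escaping_set /=; apply/cvgryPge => A.
exists (Num.bound `|A|) => // n /= An; rewrite iter_exp_map ptK modulusE /=.
apply: (@le_trans _ _ n%:R).
  apply: le_trans (ler_norm A) _; apply: (@le_trans _ _ (Num.bound `|A|)%:R).
    exact/ltW/archi_boundP.
  by rewrite ler_nat.
apply: le_trans (hn n) _; apply: le_trans (ph n) _; apply: le_trans (ler_norm _) _.
by rewrite -sqrtr_sqr ler_wsqrtr// lerDl sqr_ge0.
Qed.

Lemma open_sublevel (g : C -> R) (c : R) : continuous g -> open [set w | g w < c].
Proof.
move=> cg; rewrite (_ : [set w | g w < c] = g @^-1` [set x | x < c])//.
by apply: open_comp; [move=> x _; exact: cg|exact: open_lt].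
Qed.

Lemma open_superlevel (g : C -> R) (c : R) : continuous g -> open [set w | c < g w].
Proof.
move=> cg; rewrite (_ : [set w | c < g w] = g @^-1` [set x | c < x])//.
by apply: open_comp; [move=> x _; exact: cg|exact: open_gt].
Qed.

End Plane.

(** * The nested loops *)

Section Levels.
Variable R : realType.

(** h_(n+1) is e^(h_n) rounded up to an odd multiple of pi. Since e^(h_n) >= 9 > 2 pi, the rounding
    costs less than a factor 2 <= e. *)
Lemma levels_exist (x : R) : 8 <= x -> exists h : nat -> R,
  [/\ forall n, exists m : int, h n = 2 * pi * m%:~R + pi,
      forall n, x <= h n,
      forall n, expR (h n) <= h n.+1 <= expR (h n + 1) &
      forall n, n%:R <= h n].
Proof.
move=> x8; have [F HF] := choice (@odd_pi_multiple R).
pose h := fix h n := F (if n is n'.+1 then expR (h n') else x).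
have hS n : expR (h n) <= h n.+1 <= expR (h n) + 2 * pi by exact: (HF _).2.
have h0 : x <= h 0%N by have /andP[] := (HF x).2.
have hx n : x <= h n.
  elim: n => // n IH; have /andP[H _] := hS n.
  by apply: le_trans H; have := expR_ge1Dx (h n); lra.
exists h; split=> // [[|n]|n|n]; try exact: (HF _).1.
  have /andP[h1 h2] := hS n; rewrite h1; apply: le_trans h2 _.
  have e2 : expR (h n) * 2 <= expR (h n) * expR 1.
    by rewrite ler_wpM2l ?expR_ge0//; have := expR_ge1Dx (1 : R); lra.
  have := pi_lt4 R; have := expR_ge1Dx (h n); have := hx n; rewrite expRD; lra.
elim: n => [|n IH]; first by have := hx 0%N; lra.
have /andP[H _] := hS n; apply: le_trans H.
by rewrite -natr1; have := expR_ge1Dx (h n); lra.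
Qed.

End Levels.

Section Curves.
Variables (R : realType) (a : R) (h : nat -> R).
Local Notation C := (R[i]^o).
Local Notation step := (exp_step a).
Implicit Types (X Y : R -> R) (n N : nat) (m : int) (t x v : R).

(* On the unit circle u = x + i v the loop beta_n is the half circle a + h_n u for
   x <= 0, the arc gamma_n = (X, Y) run through on [- h_n, h_n] for x >= 0 and
   |v| <= 1/2, and the two horizontal segments for 1/2 <= |v|. *)
Definition clamp v : R := Num.max (-1) (Num.min 1 v).

Definition arcX X n v : R :=
  X (h n * clamp (2 * v)) + Num.max 0 (2 * `|v| - 1) * (a - ln (h n.+1)).
Definition arcY Y n v : R := Y (h n * clamp (2 * v)).
Definition loopX X n x v : R := if 0 <= x then arcX X n v else a + h n * x.
Definition loopY Y n x v : R := if 0 <= x then arcY Y n v else h n * v.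

(* On the strips cos t <= 0, which f maps to Re z <= a, the curve is a vertical
   line; the strips |t - 2 pi m| <= pi / 2 are preserved. *)
Record admissible X Y n : Prop := Admissible {
  adm_left : forall t, cos t <= 0 -> X t = ln (h n.+1) /\ Y t = t;
  adm_bound : forall t, ln (h n.+1) <= X t <= ln (h n.+1) + 2;
  adm_strip : forall m t, `|t - 2 * pi * m%:~R| <= pi / 2 ->
     `|Y t - 2 * pi * m%:~R| <= pi / 2 }.

Definition lifts X Y X1 Y1 n : Prop := forall t,
  expR (X t) * cos (Y t) = loopX X1 n.+1 (cos t) (sin t) - a /\
  expR (X t) * sin (Y t) = loopY Y1 n.+1 (cos t) (sin t).

(* i t + Log ((A + i B) e^(- i t)), with arg w = 2 atan (Im w / (|w| + Re w)) on
   the slit plane; A + i B is never a negative multiple of e^(i t). *)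
Definition liftX X1 Y1 n t : R :=
  let A := loopX X1 n.+1 (cos t) (sin t) - a in
  let B := loopY Y1 n.+1 (cos t) (sin t) in
  ln (A ^+ 2 + B ^+ 2) / 2.
Definition liftY X1 Y1 n t : R :=
  let A := loopX X1 n.+1 (cos t) (sin t) - a in
  let B := loopY Y1 n.+1 (cos t) (sin t) in
  t + 2 * atan ((B * cos t - A * sin t) /
    (Num.sqrt (A ^+ 2 + B ^+ 2) + (A * cos t + B * sin t))).

Hypothesis ha : a <= -1.
Hypothesis h_odd : forall n, exists m, h n = 2 * pi * m%:~R + pi.
Hypothesis h_ge8 : forall n, 8 <= h n.
Hypothesis h_gea : forall n, 3 - a <= h n.
Hypothesis h_grow : forall n, expR (h n) <= h n.+1 <= expR (h n + 1).

Lemma h_gt0 n : 0 < h n. Proof. exact: lt_le_trans (h_ge8 n). Qed.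

Lemma expR_ln_h n : expR (ln (h n)) = h n.
Proof. by rewrite lnK// posrE h_gt0. Qed.

Lemma ln_h_bound n : h n <= ln (h n.+1) <= h n + 1.
Proof. by rewrite -ler_expR -(ler_expR (ln _)) expR_ln_h. Qed.

Lemma cos_h n : cos (h n) = -1.
Proof. by have [m E] := h_odd n; rewrite -(cos_2pi_int _ m) E addrC addKr cospi. Qed.

Lemma clamp_mid v : `|v| <= 1 / 2 -> clamp (2 * v) = 2 * v.
Proof.
rewrite ler_norml /clamp => /andP[h1 h2].
by rewrite min_r ?max_r//; lra.
Qed.

Lemma clamp_top v : 1 / 2 <= v -> clamp (2 * v) = 1.
Proof. by move=> hv; rewrite /clamp min_l ?max_r//; lra. Qed.

Lemma clamp_bot v : v <= - (1 / 2) -> clamp (2 * v) = -1.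
Proof. by move=> hv; rewrite /clamp min_r ?max_l//; lra. Qed.

(** * Shape and size of a single loop *)

Section OneLevel.
Variables (X Y : R -> R) (n : nat).
Hypothesis XY : admissible X Y n.
Local Notation r := (ln (h n.+1)).

Lemma adm_top : X (h n) = r /\ Y (h n) = h n.
Proof. by apply: (adm_left XY); rewrite cos_h; lra. Qed.

Lemma adm_bot : X (- h n) = r /\ Y (- h n) = - h n.
Proof. by apply: (adm_left XY); rewrite cosN cos_h; lra. Qed.

Lemma adm_le t : t <= h n -> Y t <= h n /\ (t < h n -> Y t < h n).
Proof.
move=> th; have p0 := pi_gt0 R.
have [ct|[m tm]] := cos_strip t.
  by have [_ ->] := adm_left XY (ltW ct).
have := adm_strip XY tm; have [k E] := h_odd n.
move: tm; rewrite !ler_norml => /andP[t1 t2] /andP[y1 y2].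
(* From 2 pi m - pi / 2 <= t <= 2 pi k + pi follows 2 pi m <= 2 pi k + (3/4) 2 pi; 4/5 is a value
   between 3/4 and 1. *)
have : m <= k by apply: (@int_step _ _ _ (4/5)); move: th; rewrite ?E; lra.
rewrite -(ler_int R) => mk.
have : 2 * pi * m%:~R <= 2 * pi * k%:~R :> R by rewrite ler_pM2l//; lra.
rewrite E; lra.
Qed.

Lemma adm_ge t : - h n <= t -> - h n <= Y t /\ (- h n < t -> - h n < Y t).
Proof.
move=> th; have p0 := pi_gt0 R.
have [ct|[m tm]] := cos_strip t.
  by have [_ ->] := adm_left XY (ltW ct).
have := adm_strip XY tm; have [k E] := h_odd n.
move: tm; rewrite !ler_norml => /andP[t1 t2] /andP[y1 y2].
have : - m <= k.
  by apply: (@int_step _ _ _ (4/5)); move: th; rewrite ?mulrNz ?E; lra.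
rewrite -(ler_int R) mulrNz => mk.
have : 2 * pi * - m%:~R <= 2 * pi * k%:~R :> R by rewrite ler_pM2l//; lra.
rewrite E; lra.
Qed.

Lemma arc_mid v : `|v| <= 1 / 2 ->
  arcX X n v = X (h n * (2 * v)) /\ arcY Y n v = Y (h n * (2 * v)).
Proof.
move=> hv; rewrite /arcX /arcY clamp_mid// max_l ?mul0r ?addr0//; lra.
Qed.

Lemma arc_top v : 1 / 2 <= v ->
  arcX X n v = r + (2 * v - 1) * (a - r) /\ arcY Y n v = h n.
Proof.
move=> hv; rewrite /arcX /arcY clamp_top// mulr1 !adm_top.1 adm_top.2.
by rewrite ger0_norm ?max_r//; lra.
Qed.

Lemma arc_bot v : v <= - (1 / 2) ->
  arcX X n v = r + (- (2 * v) - 1) * (a - r) /\ arcY Y n v = - h n.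
Proof.
move=> hv; rewrite /arcX /arcY clamp_bot// mulrN1 !adm_bot.1 adm_bot.2.
rewrite ler0_norm ?max_r//; [split=> //; ring|lra|lra].
Qed.

Lemma arc_cases v : -1 <= v <= 1 ->
  [\/ 1 / 2 <= v, v <= - (1 / 2) | `|v| < 1 / 2].
Proof.
move=> /andP[? ?].
have [?|?] := leP (1/2) v; first exact: Or31.
have [?|?] := leP v (- (1/2)); first exact: Or32.
by apply: Or33; rewrite ltr_norml; apply/andP.
Qed.

(** [h_gea] gives ln h_(n+1) + 2 - a <= 2 h_n, so relative to a the arc and the segments lie in the
    rectangle [0, 2 h_n] x [- h_n, h_n], whose corners have squared modulus 5 h_n^2. They avoid the
    open disc of radius h_n: on the arc A >= h_n, on the segments |B| = h_n. *)
Lemma arc_bounds v : -1 <= v <= 1 ->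
  let A := arcX X n v - a in let B := arcY Y n v in
  [/\ h n ^+ 2 <= A ^+ 2 + B ^+ 2 <= 5 * h n ^+ 2, 0 <= A,
      (-1 < v < 1 -> 0 < A) & `|B| <= h n].
Proof.
move=> v1 A B; have hp := h_gt0 n; have ha3 := h_gea n; have ha1 := ha.
have /andP[r1 r2] := ln_h_bound n.
case: (arc_cases v1) => hv; move: v1 => /andP[v0 v1].
- rewrite /A /B; have [-> ->] := arc_top hv; rewrite gtr0_norm//.
  have -> : r + (2 * v - 1) * (a - r) - a = (2 - 2 * v) * (r - a) by ring.
  split => //; try nra.
  have : 0 <= (2 - 2 * v) * (r - a) by apply: mulr_ge0; lra.
  have : (2 - 2 * v) * (r - a) <= 2 * h n by nra.
  move: (_ * _) => q q1 q2; apply/andP; split; nra.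
- rewrite /A /B; have [-> ->] := arc_bot hv; rewrite normrN gtr0_norm//.
  have -> : r + (- (2 * v) - 1) * (a - r) - a = (2 + 2 * v) * (r - a) by ring.
  split => //; try nra.
  have : 0 <= (2 + 2 * v) * (r - a) by apply: mulr_ge0; lra.
  have : (2 + 2 * v) * (r - a) <= 2 * h n by nra.
  move: (_ * _) => q q1 q2; apply/andP; split; nra.
- rewrite /A /B; have [-> ->] := arc_mid (ltW hv).
  have /andP[x1 x2] := adm_bound XY (h n * (2 * v)).
  move: hv; rewrite ltr_norml => /andP[w1 w2].
  have [y1 _] := @adm_le (h n * (2 * v)) ltac:(nra).
  have [y2 _] := @adm_ge (h n * (2 * v)) ltac:(nra).
  move: x1 x2 y1 y2; move: (X _) (Y _) => x y x1 x2 y1 y2.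
  split; [|lra|lra|by rewrite ler_norml y1 y2].
  apply/andP; split; nra.
Qed.

(** The definition assigns x = 0 to the arc; on the circle this means v = 1 or v = -1, where the
    segments end at a + i h_n and a - i h_n, the ends of the half circle. *)
Lemma loop_left x v : x ^+ 2 + v ^+ 2 = 1 -> x <= 0 ->
  loopX X n x v = a + h n * x /\ loopY Y n x v = h n * v.
Proof.
move=> xv x0; rewrite /loopX /loopY; case: ifP => // x0'.
have {x0 x0'} x0 : x = 0 by lra.
have /orP[/eqP v1|/eqP v1] : (v == 1) || (v == -1).
- by rewrite -subr_eq0 -(addr_eq0 v) -mulf_eq0; apply/eqP; move: xv; rewrite x0; lra.
- have [-> ->] := @arc_top v ltac:(lra); rewrite x0 v1; split; ring.
- have [-> ->] := @arc_bot v ltac:(lra); rewrite x0 v1; split; ring.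
Qed.

Lemma loop_bounds x v : x ^+ 2 + v ^+ 2 = 1 ->
  let A := loopX X n x v - a in let B := loopY Y n x v in
  h n ^+ 2 <= A ^+ 2 + B ^+ 2 <= 5 * h n ^+ 2 /\ `|B| <= h n.
Proof.
move=> xv A B; have hp := h_gt0 n.
have v1 : -1 <= v <= 1 by apply/andP; split; nra.
have [x0|x0] := leP 0 x.
  have [] := arc_bounds v1; rewrite /A /B /loopX /loopY x0; split=> //.
rewrite /A /B; have [-> ->] := loop_left xv (ltW x0).
have -> : (a + h n * x - a) ^+ 2 + (h n * v) ^+ 2 = h n ^+ 2.
  by rewrite -[RHS]mulr1 -xv; ring.
have h2 := sqr_ge0 (h n).
split; first by apply/andP; split; nra.
by rewrite normrM gtr0_norm// ler_piMr ?ler_norml ?(ltW hp).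
Qed.

End OneLevel.

Lemma clamp_continuous : continuous clamp.
Proof.
have -> : clamp = (cst (-1) \max (cst 1 \min id)) by [].
apply: max_fun_continuous; first exact: cst_continuous.
by apply: min_fun_continuous; [exact: cst_continuous|move=> x; exact: cvg_id].
Qed.

Lemma arcY_continuous Y n : continuous Y -> continuous (arcY Y n).
Proof.
move=> cY v; apply: (continuous_comp (f := fun v => h n * clamp (2 * v)) (g := Y)); last exact: cY.
apply: cvgMr; apply: (continuous_comp (f := fun v => 2 * v)); last exact: clamp_continuous.
by apply: cvgMr; exact: cvg_id.
Qed.

Lemma arcX_continuous X n : continuous X -> continuous (arcX X n).
Proof.
move=> cX v; apply: cvgD; first exact: arcY_continuous.
apply: cvgMl.
have : continuous (cst 0 \max (fun v : R => 2 * `|v| - 1)); last exact.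
apply: max_fun_continuous; first exact: cst_continuous.
move=> x; apply: cvgB; last exact: cvg_cst.
by apply: cvgMr; apply: cvg_norm; exact: cvg_id.
Qed.

(** * Lifting a loop through f *)

Section Lift.
Variables (X Y : R -> R) (n : nat).
Hypothesis XY : admissible X Y n.+1.
Local Notation r := (ln (h n.+1)).
Local Notation A t := (loopX X n.+1 (cos t) (sin t) - a).
Local Notation B t := (loopY Y n.+1 (cos t) (sin t)).

Lemma lift_left t : cos t <= 0 -> A t = h n.+1 * cos t /\ B t = h n.+1 * sin t.
Proof.
by move=> ct; have [-> ->] := loop_left XY (cos2Dsin2 t) ct; split; first ring.
Qed.

(** For cos t <= 0 the loop point minus a is h_(n+1) e^(i t) itself. For cos t > 0 it lies in the
    closed right half-plane and e^(i t) in the open one, so they cannot be opposite: the contrary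
    would give A^2 + B^2 cos^2 t <= 0, against the lower bound of [arc_bounds]. *)
Lemma lift_den t :
  0 < Num.sqrt (A t ^+ 2 + B t ^+ 2) + (A t * cos t + B t * sin t).
Proof.
have hp := h_gt0 n.+1; have c2s2 := cos2Dsin2 t.
have [ct|ct] := leP (cos t) 0.
  have [-> ->] := lift_left ct.
  have -> : h n.+1 * cos t * cos t + h n.+1 * sin t * sin t = h n.+1.
    by rewrite -[RHS]mulr1 -c2s2; ring.
  by rewrite ltr_wpDl ?sqrtr_ge0.
have v1 : -1 <= sin t <= 1 by rewrite sin_geN1 sin_le1.
have [] := arc_bounds XY v1; rewrite /loopX /loopY (ltW ct) /=.
move: (_ - a) (arcY _ _ _) => x y /andP[xy _] x0 _ _.
rewrite ltNge; apply/negP.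
have N2 : Num.sqrt (x ^+ 2 + y ^+ 2) ^+ 2 = x ^+ 2 + y ^+ 2.
  by rewrite sqr_sqrtr// addr_ge0 ?sqr_ge0.
move: N2 (sqrtr_ge0 (x ^+ 2 + y ^+ 2)); move: (Num.sqrt _) => N N2 N0 H.
have xc : 0 <= x * cos t by rewrite mulr_ge0// ltW.
have Ny : N <= - (y * sin t) by lra.
have : N ^+ 2 <= (y * sin t) ^+ 2 by rewrite -[(y * _) ^+ 2]sqrrN ler_pXn2r// nnegrE; lra.
rewrite N2 exprMn sin2cos2.
have : 0 < cos t ^+ 2 by rewrite exprn_gt0.
have := sqr_ge0 x; have := sqr_ge0 y; have : 0 < h n.+1 ^+ 2 by rewrite exprn_gt0.
move: (x ^+ 2) (y ^+ 2) (cos t ^+ 2) xy => p q c; nra.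
Qed.

Lemma lift_lifts : lifts (liftX X Y n) (liftY X Y n) X Y n.
Proof. by move=> t; have [] := log_exists (lift_den t). Qed.

Lemma lift_dist t : `|liftY X Y n t - t| < pi.
Proof. by have [] := log_exists (lift_den t). Qed.

(** For the bound, e^X is between h_(n+1) and sqrt 5 h_(n+1), and sqrt 5 < 4 <= e^2. For the strips,
    the right part of the loop has Re >= a, so cos Y >= 0; as |Y - t| < pi keeps Y within 3 pi / 2
    of 2 pi m, only the strip itself remains. *)
Lemma lift_admissible : admissible (liftX X Y n) (liftY X Y n) n.
Proof.
have hp := h_gt0 n.+1.
split.
- move=> t ct; have [EA EB] := lift_left ct.
  have E : (h n.+1 * cos t) ^+ 2 + (h n.+1 * sin t) ^+ 2 = h n.+1 ^+ 2.
    by rewrite -[RHS]mulr1 -(cos2Dsin2 t); ring.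
  rewrite /liftX /liftY EA EB E; split.
    by rewrite lnXn// mulr2n; field.
  rewrite (_ : h n.+1 * sin t * cos t - _ = 0); last by ring.
  by rewrite mul0r atan0; ring.
- move=> t; have [cX sX] := lift_lifts t.
  have [/andP[lo up] _] := loop_bounds XY (cos2Dsin2 t).
  have E : expR (liftX X Y n t) ^+ 2 = A t ^+ 2 + B t ^+ 2.
    by rewrite -cX -sX -[LHS]mulr1 -(cos2Dsin2 (liftY X Y n t)); ring.
  rewrite -E in lo up; rewrite -ler_expR -(ler_expR (liftX _ _ _ _)) expRD expR_ln_h.
  have e2 := expR2_ge4 R.
  have := expR_gt0 (liftX X Y n t); move: (expR (liftX _ _ _ _)) lo up => e lo up e0.
  have [H0 E0] : 0 <= h n.+1 /\ 0 <= h n.+1 * expR 2 by nra.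
  have big : (h n.+1 * 4) ^+ 2 <= (h n.+1 * expR 2) ^+ 2.
    by rewrite ler_pXn2r ?nnegrE ?ler_wpM2l// mulr_ge0.
  apply/andP; split; rewrite -(ler_pXn2r (ltn0Sn 1)) ?nnegrE// ?(ltW e0)//.
  apply: le_trans up _; nra.
- move=> m t tm; have ct := cos_ge0_strip tm.
  have [cX _] := lift_lifts t; have dist := lift_dist t.
  have v1 : -1 <= sin t <= 1 by rewrite sin_geN1 sin_le1.
  have [_ A0 _ _] := arc_bounds XY v1.
  have cY : 0 <= cos (liftY X Y n t).
    by rewrite -(pmulr_rge0 _ (expR_gt0 (liftX X Y n t))) cX /loopX ct.
  move: cY; rewrite leNgt; apply: contraR; rewrite -ltNge => big.
  have p0 := pi_gt0 R.
  move: tm dist big; move: (liftY X Y n t) => y.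
  rewrite ler_norml ltr_norml lter_normr => /andP[t1 t2] /andP[d1 d2] /orP[b|b].
    have [b'|b'] := leP (y - 2 * pi * m%:~R) pi.
      by apply: (@cos_lt0_strip _ y m); rewrite ger0_norm; [apply/andP|lra].
    apply: (@cos_lt0_strip _ y (m + 1)); rewrite intrD ler0_norm; last by lra.
    by apply/andP; split; lra.
  have [b'|b'] := leP (- (y - 2 * pi * m%:~R)) pi.
    by apply: (@cos_lt0_strip _ y m); rewrite ler0_norm; [apply/andP|lra].
  apply: (@cos_lt0_strip _ y (m - 1)); rewrite intrB ger0_norm; last by lra.
  by apply/andP; split; lra.
Qed.

Lemma loop_cts (f g : R -> R) : continuous f -> continuous g -> 
  (forall t, cos t = 0 -> f t = g t) ->
  continuous (fun t => if 0 <= cos t then f t else g t).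
Proof.
move=> cf cg fg; apply/continuous_subspace_setT.
apply: paste_continuous => // [|x _]; [exact: continuous_cos|exact: fg].
Qed.

Lemma loopX_continuous : continuous X -> continuous (fun t => A t).
Proof.
move=> cX t; apply: cvgB; last exact: cvg_cst.
apply: (@loop_cts (fun t => arcX X n.+1 (sin t)) (fun t => a + h n.+1 * cos t)).
- move=> u; apply: (continuous_comp (f := sin)); first exact: continuous_sin.
  exact: arcX_continuous.
- move=> u; apply: cvgD; first exact: cvg_cst.
  by apply: cvgMr; exact: continuous_cos.
- move=> u cu; have [] := loop_left XY (cos2Dsin2 u) _; first by rewrite cu.
  by rewrite /loopX cu lexx.
Qed.

Lemma loopY_continuous : continuous Y -> continuous (fun t => B t).
Proof.
move=> cY.
apply: (@loop_cts (fun t => arcY Y n.+1 (sin t)) (fun t => h n.+1 * sin t)).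
- move=> u; apply: (continuous_comp (f := sin)); first exact: continuous_sin.
  exact: arcY_continuous.
- by move=> u; apply: cvgMr; exact: continuous_sin.
- move=> u cu; have [] := loop_left XY (cos2Dsin2 u) _; first by rewrite cu.
  by rewrite /loopY cu lexx.
Qed.

Lemma lift_continuous : continuous X -> continuous Y ->
  continuous (liftX X Y n) /\ continuous (liftY X Y n).
Proof.
move=> /loopX_continuous cA /loopY_continuous cB.
have cN : continuous (fun t => A t ^+ 2 + B t ^+ 2).
  move=> t; apply: cvgD.
    apply: (continuous_comp (f := fun t => A t) (g := fun x => x ^+ 2)); first exact: cA.
    exact: exprn_continuous.
  apply: (continuous_comp (f := fun t => B t) (g := fun x => x ^+ 2)); first exact: cB.
  exact: exprn_continuous.
have N0 t : 0 < A t ^+ 2 + B t ^+ 2.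
  have [/andP[lo _] _] := loop_bounds XY (cos2Dsin2 t).
  by apply: lt_le_trans lo; rewrite exprn_gt0// h_gt0.
split=> t.
  apply: cvgMl; apply: (continuous_comp (f := fun t => A t ^+ 2 + B t ^+ 2)).
    exact: cN.
  exact: continuous_ln.
apply: cvgD; first exact: cvg_id.
apply: cvgMr.
apply: (continuous_comp (f := fun t => (B t * cos t - A t * sin t) /
    (Num.sqrt (A t ^+ 2 + B t ^+ 2) + (A t * cos t + B t * sin t)))); last exact: continuous_atan.
have cc := @continuous_cos R t; have cs := @continuous_sin R t.
apply: cvgM; first by apply: cvgB; apply: cvgM => //; [exact: cB|exact: cA].
apply: cvgV; first by rewrite gt_eqF// lift_den.
apply: cvgD.
  apply: (continuous_comp (f := fun t => A t ^+ 2 + B t ^+ 2)); first exact: cN.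
  exact: sqrt_continuous.
by apply: cvgD; apply: cvgM => //; [exact: cA|exact: cB].
Qed.

End Lift.

(** Where the cosine is negative the two lifts coincide. Elsewhere both lie in one strip to the
    right of ln h_(n+1), where exp expands by at least h_(n+1) / 4 >= 2; this is the use of h >= 8.
    The horizontal segments of the two loops agree, so their contribution cancels in the difference
    of the images. *)
Lemma lift_contract X Y X1 Y1 X' Y' X1' Y1' n (D : R) :
  admissible X Y n -> admissible X' Y' n ->
  lifts X Y X1 Y1 n -> lifts X' Y' X1' Y1' n ->
  (forall t, (X1 t - X1' t) ^+ 2 + (Y1 t - Y1' t) ^+ 2 <= D) ->
  forall t, (X t - X' t) ^+ 2 + (Y t - Y' t) ^+ 2 <= D / 4.
Proof.
move=> g g' l l' HD t.
have D0 : 0 <= D by apply: le_trans (HD 0); rewrite addr_ge0 ?sqr_ge0.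
have [ct|[m tm]] := cos_strip t.
  have [-> ->] := adm_left g (ltW ct); have [-> ->] := adm_left g' (ltW ct).
  by rewrite !subrr expr0n addr0 divr_ge0.
have := adm_strip g tm; have := adm_strip g' tm; have ct := cos_ge0_strip tm.
have /andP[x1 _] := adm_bound g t; have /andP[x2 _] := adm_bound g' t.
rewrite !ler_norml => /andP[y1 y2] /andP[y3 y4].
have dy : `|Y t - Y' t| <= pi by rewrite ler_norml; apply/andP; split; lra.
have := exp_expand x1 x2 dy; rewrite expR_ln_h.
have [-> ->] := l t; have [-> ->] := l' t; rewrite /loopX /loopY ct /arcX /arcY.
have := HD (h n.+1 * clamp (2 * sin t)).
set s := h n.+1 * _; move=> H1 H2.
have H3 : h n.+1 ^+ 2 / 16 * ((X t - X' t) ^+ 2 + (Y t - Y' t) ^+ 2) <= D.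
  apply: le_trans H2 _; apply: le_trans H1; rewrite le_eqVlt; apply/orP; left.
  by apply/eqP; ring.
have H4 : 4 <= h n.+1 ^+ 2 / 16 by have := h_ge8 n.+1; nra.
have : 0 <= (X t - X' t) ^+ 2 + (Y t - Y' t) ^+ 2 by rewrite addr_ge0 ?sqr_ge0.
move: (_ + _) H3 => q; nra.
Qed.

(** The vertical line on level n + N, lifted N times down to level n. *)
Fixpoint approx N n : (R -> R) * (R -> R) :=
  if N is N'.+1 then
    let p := approx N' n.+1 in (liftX p.1 p.2 n, liftY p.1 p.2 n)
  else (cst (ln (h n.+1)), id).

Lemma approx_admissible N n : admissible (approx N n).1 (approx N n).2 n.
Proof.
elim: N n => [|N IH] n /=; last exact: lift_admissible.
by split=> // t; rewrite lexx /= lerDl.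
Qed.

Lemma approx_continuous N n :
  continuous (approx N n).1 /\ continuous (approx N n).2.
Proof.
elim: N n => [|N IH] n /=; first by split=> x; [exact: cvg_cst|exact: cvg_id].
have [cX cY] := IH n.+1.
exact: (lift_continuous (@approx_admissible N n.+1)).
Qed.

Lemma approx_lifts N n : lifts (approx N.+1 n).1 (approx N.+1 n).2
  (approx N n.+1).1 (approx N n.+1).2 n.
Proof. exact: lift_lifts (@approx_admissible N n.+1). Qed.

(** A first lift moves the line by at most 2 horizontally and pi < 4 vertically, and 2^2 + 4^2 <=
    5^2. Each further lift halves the difference. *)
Lemma approx_step N n t :
  ((approx N.+1 n).1 t - (approx N n).1 t) ^+ 2 +
  ((approx N.+1 n).2 t - (approx N n).2 t) ^+ 2 <= (5 / 2 ^+ N) ^+ 2.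
Proof.
elim: N n t => [|N IH] n t.
  have /andP[x1 x2] := adm_bound (@approx_admissible 1 n) t.
  have y := lift_dist (@approx_admissible 0 n.+1) t.
  have p4 := pi_lt4 R.
  rewrite expr0 divr1.
  change ((approx 0 n).1 t) with (ln (h n.+1)).
  change ((approx 0 n).2 t) with t.
  move: y; change (liftY _ _ _ t) with ((approx 1 n).2 t); rewrite ltr_norml => /andP[y1 y2].
  nra.
have := lift_contract (@approx_admissible N.+2 n) (@approx_admissible N.+1 n)
  (@approx_lifts _ _) (@approx_lifts _ _) (IH n.+1) t.
move=> H; apply: le_trans H _.
by rewrite [2 ^+ N.+1]exprS le_eqVlt; apply/orP; left; apply/eqP; field; rewrite gt_eqF// exprn_gt0.
Qed.

(** Admissibility consists of closed conditions and survives the limit. Stage N + 1 on level n lifts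
    stage N on level n + 1, so [lifts] follows from uniqueness of limits. *)
Lemma curves_exist : exists X Y : nat -> R -> R, forall n,
  [/\ continuous (X n), continuous (Y n), admissible (X n) (Y n) n &
      lifts (X n) (Y n) (X n.+1) (Y n.+1) n].
Proof.
have st N n t := sqr_sum_le (divr_ge0 (ler0n _ 5) (exprn_ge0 N (ler0n _ 2))) (approx_step N n t).
have HX n : exists2 g : R -> R, continuous g &
    forall N t, `|g t - (approx N n).1 t| <= 2 * 5 / 2 ^+ N.
  apply: geometric_limit => [N t|N]; first by have [] := st N n t.
  by have [] := approx_continuous N n.
have HY n : exists2 g : R -> R, continuous g &
    forall N t, `|g t - (approx N n).2 t| <= 2 * 5 / 2 ^+ N.
  apply: geometric_limit => [N t|N]; first by have [] := st N n t.
  by have [] := approx_continuous N n.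
have HF n : exists p : (R -> R) * (R -> R),
    [/\ continuous p.1, continuous p.2,
      forall N t, `|p.1 t - (approx N n).1 t| <= 10 / 2 ^+ N &
      forall N t, `|p.2 t - (approx N n).2 t| <= 10 / 2 ^+ N].
  have [f cf Hf] := HX n; have [g cg Hg] := HY n.
  have E : 10 = 2 * 5 :> R by lra.
  by exists (f, g); split=> //= N t; rewrite E.
have [F {}HF] := choice HF.
exists (fun n => (F n).1), (fun n => (F n).2) => n.
have [cX cY hX hY] := HF n; split=> //.
- split.
  + move=> t ct; split; apply/eqP; rewrite -subr_eq0 -normr_le0;
      apply: (@le_approx R _ _ 10) => N; rewrite add0r.
      by have [<- _] := adm_left (approx_admissible N n) ct.
    by have [_ {2}<-] := adm_left (approx_admissible N n) ct.
  + move=> t; apply/andP; split; apply: (@le_approx R _ _ 10) => N;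
    have := hX N t; rewrite ler_norml => /andP[a1 a2];
    have /andP[b1 b2] := adm_bound (approx_admissible N n) t; lra.
  + move=> m t tm; rewrite ler_norml; apply/andP; split;
    apply: (@le_approx R _ _ 10) => N;
    have := hY N t; rewrite ler_norml => /andP[a1 a2];
    have := adm_strip (approx_admissible N n) tm;
    rewrite ler_norml => /andP[b1 b2]; lra.
- move=> t.
  have [_ _ hX1 hY1] := HF n.+1.
  have half N : 10 / 2 ^+ N.+1 <= 10 / 2 ^+ N :> R.
    by rewrite ler_wpM2l// lef_pV2 ?posrE ?exprn_gt0// ler_weXn2l// ler1n.
  have cvX : (approx N.+1 n).1 t @[N --> \oo] --> (F n).1 t.
    by apply: (@cvg_approx _ _ _ 10) => N; apply: le_trans (hX _ _) _.
  have cvY : (approx N.+1 n).2 t @[N --> \oo] --> (F n).2 t.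
    by apply: (@cvg_approx _ _ _ 10) => N; apply: le_trans (hY _ _) _.
  have cvE : expR ((approx N.+1 n).1 t) @[N --> \oo] --> expR ((F n).1 t).
    by apply: continuous_cvg cvX; exact: continuous_expR.
  have C0 N : 0 <= 10 / 2 ^+ N :> R by rewrite divr_ge0// exprn_ge0.
  split.
    apply: (@lim_unique _ (fun N => expR ((approx N.+1 n).1 t) * cos ((approx N.+1 n).2 t))).
    * apply: cvgM => //; apply: continuous_cvg cvY; exact: continuous_cos.
    * apply: (@cvg_approx _ _ _ 10) => N; rewrite (approx_lifts N n t).1.
      rewrite /loopX; case: ifP => _; last by rewrite subrr normr0.
      rewrite /arcX; apply: le_trans (hX1 N (h n.+1 * clamp (2 * sin t))).
      rewrite le_eqVlt; apply/orP; left; apply/eqP; congr `|_|; ring.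
  apply: (@lim_unique _ (fun N => expR ((approx N.+1 n).1 t) * sin ((approx N.+1 n).2 t))).
  * apply: cvgM => //; apply: continuous_cvg cvY; exact: continuous_sin.
  * apply: (@cvg_approx _ _ _ 10) => N; rewrite (approx_lifts N n t).2.
    rewrite /loopY; case: ifP => _; last by rewrite subrr normr0.
    exact: hY1.
Qed.

(* Inside and outside of beta_n, decided after at most k iterations.  By
   [loop_bounds], beta_n lies between the circles of radii h_n and sqrt 5 h_n. *)
Fixpoint inside k n (p : R * R) : Prop :=
  (p.1 - a) ^+ 2 + p.2 ^+ 2 < h n ^+ 2 \/
  if k is k'.+1 then [/\ a < p.1, `|p.2| < h n & inside k' n.+1 (step p)]
  else False.

Fixpoint outside k n (p : R * R) : Prop :=
  [\/ p.1 < a /\ h n ^+ 2 < (p.1 - a) ^+ 2 + p.2 ^+ 2, h n < `|p.2|,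
      5 * h n ^+ 2 < (p.1 - a) ^+ 2 + p.2 ^+ 2 |
      if k is k'.+1 then a < p.1 /\ outside k' n.+1 (step p) else False].

Lemma step_modulus p :
  ((step p).1 - a) ^+ 2 + (step p).2 ^+ 2 = expR p.1 ^+ 2.
Proof.
by rewrite /= -[RHS]mulr1 -(cos2Dsin2 p.2); ring.
Qed.

(** Since |f(p) - a| = e^(Re p), the bound on level n + 1 yields Re p <= ln h_(n+1) + 2, which puts
    p into the rectangle of [arc_bounds]. *)
Lemma inside_bound k n p : inside k n p ->
  (p.1 - a) ^+ 2 + p.2 ^+ 2 <= 5 * h n ^+ 2.
Proof.
elim: k n p => [|k IH] n p /= [|]//; have h2 := sqr_ge0 (h n); try lra.
move=> [ap pn /IH]; rewrite step_modulus => H.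
have hp := h_gt0 n.+1; have h0 := h_gt0 n; have ha3 := h_gea n; have ha1 := ha.
have /andP[r1 r2] := ln_h_bound n.
have e2 := expR2_ge4 R.
have : expR p.1 <= expR (ln (h n.+1) + 2).
  rewrite expRD expR_ln_h -(ler_pXn2r (ltn0Sn 1)) ?nnegrE ?expR_ge0 ?mulr_ge0 ?expR_ge0 ?(ltW hp)//.
  have big : (h n.+1 * 4) ^+ 2 <= (h n.+1 * expR 2) ^+ 2.
    by rewrite ler_pXn2r ?nnegrE ?ler_wpM2l ?mulr_ge0 ?(ltW hp) ?expR_ge0.
  by apply: le_trans H _; apply: le_trans big; nra.
rewrite ler_expR => p1; move: pn; rewrite ltr_norml => /andP[? ?].
have : (p.1 - a) ^+ 2 <= (2 * h n) ^+ 2 by rewrite ler_pXn2r// ?nnegrE; lra.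
have : p.2 ^+ 2 <= h n ^+ 2 by nra.
lra.
Qed.

(** In the recursive case e^(Re p) >= h_(n+1), so Re p >= ln h_(n+1) >= h_n and already Re p - a
    exceeds h_n. *)
Lemma outside_disc k n p : outside k n p ->
  h n ^+ 2 <= (p.1 - a) ^+ 2 + p.2 ^+ 2.
Proof.
have h0 := h_gt0 n; have h2 := sqr_ge0 (h n).
have big q : h n < `|q| -> h n ^+ 2 <= q ^+ 2.
  by move=> hq; rewrite -(real_normK (num_real q)) ler_pXn2r ?nnegrE ?(ltW h0) ?(ltW hq).
have p2 := sqr_ge0 (p.1 - a); have q2 := sqr_ge0 p.2.
elim: k n p h0 h2 big p2 q2 => [|k IH] n p h0 h2 big p2 q2 /= [[_ ?]|/big ?|?|//]; try lra.
move=> [ap /IH]; rewrite step_modulus => H.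
have hp := h_gt0 n.+1; have ha1 := ha.
have /andP[r1 r2] := ln_h_bound n.
have : expR (ln (h n.+1)) <= expR p.1.
  rewrite expR_ln_h -(ler_pXn2r (ltn0Sn 1)) ?nnegrE ?expR_ge0 ?(ltW hp)//.
  apply: H => //; rewrite ?sqr_ge0// => q hq.
  by rewrite -(real_normK (num_real q)) ler_pXn2r ?nnegrE ?(ltW hp) ?(ltW hq).
rewrite ler_expR => p1.
have : h n ^+ 2 <= (p.1 - a) ^+ 2 by rewrite ler_pXn2r// ?nnegrE; lra.
lra.
Qed.

(** The two size bounds and the strict inequalities exclude every pair of clauses except the two
    recursive ones, and those follow the same orbit to the next level. *)
Lemma inside_outside_disjoint k j n p : inside k n p -> outside j n p -> False.
Proof.
elim: k j n p => [|k IH] j n p I O; move: (I) => /= [d|//].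
- by have := outside_disc O; lra.
- by have := outside_disc O; lra.
move=> [ap pn Is]; have Ib := inside_bound I.
by case: j O => [|j] /= [[? _]|?|?|//]; [lra|lra|lra|lra|lra|lra|case=> _; exact: IH Is].
Qed.

Lemma continuous_dist2 : continuous (fun w : C => (complex.Re w - a) ^+ 2 + complex.Im w ^+ 2).
Proof.
move=> w; have FF : Filter (nbhs w) := @nbhs_filter C w.
have cR : complex.Re u @[u --> w] --> complex.Re w := @continuous_Re R w.
have cI : complex.Im u @[u --> w] --> complex.Im w := @continuous_Im R w.
have cRa : complex.Re u - a @[u --> w] --> complex.Re w - a by apply: cvgB => //; exact: cvg_cst.
apply: cvgD.
  exact: (cvg_comp _ (fun x : R => x ^+ 2) cRa (@exprn_continuous R 2 _)).
exact: (cvg_comp _ (fun x : R => x ^+ 2) cI (@exprn_continuous R 2 _)).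
Qed.

Lemma continuous_absIm : continuous (fun w : C => `|complex.Im w|).
Proof.
move=> w; have FF : Filter (nbhs w) := @nbhs_filter C w.
have cI : complex.Im u @[u --> w] --> complex.Im w := @continuous_Im R w.
exact: cvg_norm cI.
Qed.

Lemma open_step (P : R * R -> Prop) :
  open [set w : C | P (coord w)] -> open [set w : C | P (step (coord w))].
Proof.
move=> oP; rewrite (_ : [set w | _] = exp_map (a%:C : C) @^-1` [set w | P (coord w)]).
  by apply: open_comp => // w _; exact: exp_map_continuous.
by apply/seteqP; split=> w /=; rewrite exp_mapE ptK.
Qed.

Lemma open_inside k n : open [set w : C | inside k n (coord w)].
Proof.
elim: k n => [|k IH] n.
  rewrite (_ : [set w | _] =
    [set w : C | (complex.Re w - a) ^+ 2 + complex.Im w ^+ 2 < h n ^+ 2]).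
    by apply: open_sublevel; exact: continuous_dist2.
  by apply/seteqP; split=> w /=; [case|left].
rewrite (_ : [set w | _] =
    [set w : C | (complex.Re w - a) ^+ 2 + complex.Im w ^+ 2 < h n ^+ 2] `|`
    ([set w : C | a < complex.Re w] `&` [set w : C | `|complex.Im w| < h n] `&`
     [set w : C | inside k n.+1 (step (coord w))])).
  apply: openU; first by apply: open_sublevel; exact: continuous_dist2.
  apply: openI; last exact: open_step.
  apply: openI; first by apply: open_superlevel; exact: continuous_Re.
  by apply: open_sublevel; exact: continuous_absIm.
by apply/seteqP; split=> w /= [?|]; (try by left); [case=> ? ? ?; right|case=> -[? ?] ?; right].
Qed.

Lemma open_outside k n : open [set w : C | outside k n (coord w)].
Proof.
elim: k n => [|k IH] n.
  rewrite (_ : [set w | _] =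
    ([set w : C | complex.Re w < a] `&`
     [set w : C | h n ^+ 2 < (complex.Re w - a) ^+ 2 + complex.Im w ^+ 2]) `|`
    [set w : C | h n < `|complex.Im w|] `|`
    [set w : C | 5 * h n ^+ 2 < (complex.Re w - a) ^+ 2 + complex.Im w ^+ 2]).
    apply: openU; last by apply: open_superlevel; exact: continuous_dist2.
    apply: openU; last by apply: open_superlevel; exact: continuous_absIm.
    apply: openI; first by apply: open_sublevel; exact: continuous_Re.
    by apply: open_superlevel; exact: continuous_dist2.
  apply/seteqP; split=> w /=; first by case=> // ?; [left; left|left; right|right].
  by case=> [[?|?]|?]; [constructor 1|constructor 2|constructor 3].
rewrite (_ : [set w | _] =
    ([set w : C | complex.Re w < a] `&`
     [set w : C | h n ^+ 2 < (complex.Re w - a) ^+ 2 + complex.Im w ^+ 2]) `|`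
    [set w : C | h n < `|complex.Im w|] `|`
    [set w : C | 5 * h n ^+ 2 < (complex.Re w - a) ^+ 2 + complex.Im w ^+ 2] `|`
    ([set w : C | a < complex.Re w] `&` [set w : C | outside k n.+1 (step (coord w))])).
  apply: openU; last first.
    by apply: openI; [apply: open_superlevel; exact: continuous_Re|exact: open_step].
  apply: openU; last by apply: open_superlevel; exact: continuous_dist2.
  apply: openU; last by apply: open_superlevel; exact: continuous_absIm.
  apply: openI; first by apply: open_sublevel; exact: continuous_Re.
  by apply: open_superlevel; exact: continuous_dist2.
apply/seteqP; split=> w /=.
  by case=> ?; [left; left; left|left; left; right|left; right|right].
by case=> [[[?|?]|?]|?]; [constructor 1|constructor 2|constructor 3|constructor 4].
Qed.

(** * Injectivity of the loops and orbits of their points *)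

Section Sequence.
Variables X Y : nat -> R -> R.
Hypothesis XY : forall n, [/\ continuous (X n), continuous (Y n),
  admissible (X n) (Y n) n & lifts (X n) (Y n) (X n.+1) (Y n.+1) n].

Definition loop n x v : R * R := (loopX (X n) n x v, loopY (Y n) n x v).

Let adm n : admissible (X n) (Y n) n. Proof. by have [] := XY n. Qed.

Lemma step_curve n t :
  step (X n t, Y n t) = loop n.+1 (cos t) (sin t).
Proof. by have [_ _ _ /(_ t)[E1 E2]] := XY n; rewrite /exp_step /loop /= E1 E2 subrK. Qed.

Lemma circle_v x v : x ^+ 2 + v ^+ 2 = 1 -> -1 <= v <= 1.
Proof. by move=> H; apply/andP; split; nra. Qed.

Lemma circle_pos x x' v : x ^+ 2 + v ^+ 2 = 1 -> x' ^+ 2 + v ^+ 2 = 1 ->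
  0 <= x -> 0 <= x' -> x = x'.
Proof.
move=> H H' x0 x0'; apply/eqP; rewrite -(eqrXn2 (n := 2))//; apply/eqP; lra.
Qed.

(** The open half circle has Re < a and the rest Re >= a; the segments have |Im| = h_n and the
    interior of the arc |Im| < h_n. Only coincidences within the arc are left, for [curve_inj] to
    exclude. *)
Lemma loop_inj n x v x' v' :
  x ^+ 2 + v ^+ 2 = 1 -> x' ^+ 2 + v' ^+ 2 = 1 ->
  loop n x v = loop n x' v' ->
  (x = x' /\ v = v') \/
  [/\ 0 <= x, 0 <= x', `|v| < 1 / 2, `|v'| < 1 / 2 &
      X n (h n * (2 * v)) = X n (h n * (2 * v')) /\
      Y n (h n * (2 * v)) = Y n (h n * (2 * v'))].
Proof.
move=> xv xv' []; have h0 := h_gt0 n.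
have v1 := circle_v xv; have v1' := circle_v xv'.
have [x0|x0] := ltP x 0.
  have [-> ->] := loop_left (adm n) xv (ltW x0).
  have [x0'|x0'] := ltP x' 0.
    have [-> ->] := loop_left (adm n) xv' (ltW x0').
    move=> /addrI /mulfI -> ; rewrite ?gt_eqF// => /mulfI -> ; rewrite ?gt_eqF//.
    by left.
  rewrite /loopX x0' => E; have [_ A0 _ _] := arc_bounds (adm n) v1'.
  by exfalso; nra.
have [x0'|x0'] := ltP x' 0.
  have [-> _] := loop_left (adm n) xv' (ltW x0').
  rewrite /loopX x0 => E; have [_ A0 _ _] := arc_bounds (adm n) v1.
  by exfalso; nra.
rewrite /loopX /loopY x0 x0'.
have /andP[r1 _] := ln_h_bound n; have ha1 := ha.
have mid w : `|w| < 1 / 2 -> - h n < Y n (h n * (2 * w)) < h n.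
  rewrite ltr_norml => /andP[w1 w2].
  have [_ y1] := adm_le (adm n) (t := h n * (2 * w)) ltac:(nra).
  have [_ y2] := adm_ge (adm n) (t := h n * (2 * w)) ltac:(nra).
  by rewrite y1 ?y2; nra.
case: (arc_cases v1) => hv; case: (arc_cases v1') => hv'.
- have [-> ->] := arc_top (adm n) hv; have [-> ->] := arc_top (adm n) hv' => E _.
  left; have vv : v = v' by nra.
  by split=> //; apply: circle_pos (xv) _ _ _ => //; rewrite vv.
- have [_ ->] := arc_top (adm n) hv; have [_ ->] := arc_bot (adm n) hv' => _ E; lra.
- have [_ ->] := arc_top (adm n) hv; have [_ ->] := arc_mid (X n) (Y n) n (ltW hv') => _ E.
  by have /andP[] := mid _ hv'; lra.
- have [_ ->] := arc_bot (adm n) hv; have [_ ->] := arc_top (adm n) hv' => _ E; lra.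
- have [-> ->] := arc_bot (adm n) hv; have [-> ->] := arc_bot (adm n) hv' => E _.
  left; have vv : v = v' by nra.
  by split=> //; apply: circle_pos (xv) _ _ _ => //; rewrite vv.
- have [_ ->] := arc_bot (adm n) hv; have [_ ->] := arc_mid (X n) (Y n) n (ltW hv') => _ E.
  by have /andP[] := mid _ hv'; lra.
- have [_ ->] := arc_mid (X n) (Y n) n (ltW hv); have [_ ->] := arc_top (adm n) hv' => _ E.
  by have /andP[] := mid _ hv; lra.
- have [_ ->] := arc_mid (X n) (Y n) n (ltW hv); have [_ ->] := arc_bot (adm n) hv' => _ E.
  by have /andP[] := mid _ hv; lra.
- have [-> ->] := arc_mid (X n) (Y n) n (ltW hv); have [-> ->] := arc_mid (X n) (Y n) n (ltW hv').
  by move=> E1 E2; right; split.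
Qed.

Lemma adm_dist n t : `|Y n t - t| <= pi.
Proof.
have p0 := pi_gt0 R; have [ct|[m tm]] := cos_strip t.
  by have [_ ->] := adm_left (adm n) (ltW ct); rewrite subrr normr0 ltW.
have := adm_strip (adm n) tm; move: tm; rewrite !ler_norml.
by move=> /andP[? ?] /andP[? ?]; apply/andP; split; lra.
Qed.

Lemma adm_same_strip n s t : Y n s = Y n t -> 0 <= cos s -> 0 <= cos t ->
  `|s - t| <= pi.
Proof.
move=> E cs ct; have p0 := pi_gt0 R.
have [?|[m sm]] := cos_strip s; first by lra.
have [?|[k tk]] := cos_strip t; first by lra.
have := adm_strip (adm n) sm; have := adm_strip (adm n) tk; rewrite E.
move: sm tk; rewrite !ler_norml => /andP[? ?] /andP[? ?] /andP[? ?] /andP[? ?].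
have mk : m = k.
  by apply/eqP; rewrite eq_le; apply/andP; split; apply: (@int_step _ _ _ (4/5)); lra.
by subst m; apply/andP; split; lra.
Qed.

(** Applying f turns a coincidence on the arc into one on the next loop. If that again lies on the
    arc, the new parameters are 2 h_(n+1) sin s and 2 h_(n+1) sin t. For |sin| < 1/2 the sines
    control the distance of the parameters, |s - t|^2 <= 32 |sin s - sin t|^2, and h >= 8 yields the
    factor 2. *)
Lemma curve_expand n s t : X n s = X n t -> Y n s = Y n t ->
  s = t \/ exists s1 t1, [/\ X n.+1 s1 = X n.+1 t1, Y n.+1 s1 = Y n.+1 t1 &
                           2 * `|s - t| <= `|s1 - t1|].
Proof.
move=> EX EY; have := step_curve n s; rewrite EX EY step_curve => /esym E.
have c2 : 2 * (1 - cos (s - t)) = (cos s - cos t) ^+ 2 + (sin s - sin t) ^+ 2.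
  by rewrite cosB; have := cos2Dsin2 s; have := cos2Dsin2 t; nra.
case: (loop_inj (cos2Dsin2 s) (cos2Dsin2 t) E) => [[Ec Es]|[cs ct ss st [E1 E2]]].
  left; have [cs|cs] := ltP (cos s) 0.
    have [_ <-] := adm_left (adm n) (ltW cs); rewrite EY.
    by rewrite Ec in cs; have [_ ->] := adm_left (adm n) (ltW cs).
  have ct := cs; rewrite Ec in ct.
  have := one_sub_cos_ge (adm_same_strip EY cs ct); rewrite c2 Ec Es !subrr => H.
  by apply/eqP; rewrite -subr_eq0 -sqrf_eq0 eq_le sqr_ge0 andbT; lra.
right; exists (h n.+1 * (2 * sin s)), (h n.+1 * (2 * sin t)); split=> //.
have := one_sub_cos_ge (adm_same_strip EY cs ct); rewrite c2 => H.
have h8 := h_ge8 n.+1.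
(* Since x^2 + u^2 = y^2 + v^2, (x - y) (x + y) = (v - u) (u + v), and |u|, |v| < 1/2 gives x + y >=
   1 >= |u + v|. *)
have H2 : (cos s - cos t) ^+ 2 <= (sin s - sin t) ^+ 2.
  move: ss st (cos2Dsin2 s) (cos2Dsin2 t) cs ct.
  rewrite !ltr_norml => /andP[s1 s2] /andP[t1 t2].
  move: (cos s) (cos t) (sin s) (sin t) s1 s2 t1 t2 => x y u v s1 s2 t1 t2 e1 e2 x0 y0.
  have x1 : 1 / 2 < x by nra.
  have y1 : 1 / 2 < y by nra.
  have E3 : (x - y) * (x + y) = (v - u) * (u + v) by nra.
  have E4 : (x - y) ^+ 2 * (x + y) ^+ 2 = (u - v) ^+ 2 * (u + v) ^+ 2.
    by rewrite -exprMn E3; ring.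
  have xy1 : 1 <= (x + y) ^+ 2 by nra.
  have uv1 : (u + v) ^+ 2 <= 1 by nra.
  have := sqr_ge0 (x - y); have := sqr_ge0 (u - v); nra.
rewrite -(ler_pXn2r (ltn0Sn 1)) ?nnegrE ?mulr_ge0//.
rewrite exprMn !real_normK ?num_real//.
rewrite (_ : h n.+1 * (2 * sin s) - _ = 2 * h n.+1 * (sin s - sin t)); last by ring.
rewrite !exprMn; have := sqr_ge0 (sin s - sin t).
move: ((sin s - sin t) ^+ 2) H2 H => q H2 H q0.
have h64 : 64 <= h n.+1 ^+ 2 by nra.
have : 64 * q <= h n.+1 ^+ 2 * q by rewrite ler_wpM2r.
lra.
Qed.

(** On every level coinciding points have parameters at most 2 pi apart, by [adm_dist]; a nonzero
    difference would double from level to level. *)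
Lemma curve_inj n s t : X n s = X n t -> Y n s = Y n t -> s = t.
Proof.
move=> EX EY.
have H k : 2 ^+ k * `|s - t| <= 2 * pi.
  elim: k n s t EX EY => [|k IH] n' s' t' EX EY.
    have := adm_dist n' s'; have := adm_dist n' t'; rewrite EY expr0 mul1r.
    rewrite !ler_norml => /andP[? ?] /andP[? ?]; apply/andP; split; lra.
  case: (curve_expand EX EY) => [->|[s1 [t1 [E1 E2 H]]]].
    by rewrite subrr normr0 mulr0; have := pi_gt0 R; lra.
  apply: le_trans (IH _ _ _ E1 E2).
  by rewrite exprSr -mulrA ler_wpM2l// exprn_ge0.
apply/eqP; rewrite -subr_eq0 -normr_le0; apply: (@le_approx R _ _ (2 * pi)) => k.
by rewrite add0r ler_pdivlMr ?exprn_gt0// mulrC.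
Qed.

Lemma loop_injective n x v x' v' :
  x ^+ 2 + v ^+ 2 = 1 -> x' ^+ 2 + v' ^+ 2 = 1 ->
  loop n x v = loop n x' v' -> x = x' /\ v = v'.
Proof.
move=> xv xv' E; have h0 := h_gt0 n.
case: (loop_inj xv xv' E) => // -[x0 x0' _ _ [EX EY]].
have vv : v = v' by have := curve_inj EX EY; nra.
by split=> //; apply: circle_pos (xv) _ _ _ => //; rewrite vv.
Qed.

Lemma loop_next n x v : x ^+ 2 + v ^+ 2 = 1 ->
  [\/ (loop n x v).1 < 0, (step (loop n x v)).1 < 0 |
      h n <= (loop n x v).1 /\
      exists t, step (loop n x v) = loop n.+1 (cos t) (sin t)].
Proof.
move=> xv; have ha1 := ha; have h0 := h_gt0 n.
have [x0|x0] := leP x 0.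
  apply: Or31; rewrite /loop /=; have [-> _] := loop_left (adm n) xv x0; nra.
have e0 := expR_gt0 (loop n x v).1.
have v1 := circle_v xv; case: (arc_cases v1) => hv.
- apply: Or32; rewrite /exp_step /= in e0 *; rewrite /loopY (ltW x0).
  by have [_ ->] := arc_top (adm n) hv; rewrite cos_h; lra.
- apply: Or32; rewrite /exp_step /= in e0 *; rewrite /loopY (ltW x0).
  by have [_ ->] := arc_bot (adm n) hv; rewrite cosN cos_h; lra.
- have -> : loop n x v = (X n (h n * (2 * v)), Y n (h n * (2 * v))).
    rewrite /loop /loopX /loopY (ltW x0).
    by have [-> ->] := arc_mid (X n) (Y n) n (ltW hv).
  apply: Or33; split; last by eexists; exact: step_curve.
  have /andP[+ _] := adm_bound (adm n) (h n * (2 * v)).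
  by have /andP[+ _] := ln_h_bound n; exact: le_trans.
Qed.

Lemma loop_orbit x v : x ^+ 2 + v ^+ 2 = 1 ->
  (exists k, (iter k step (loop 0 x v)).1 < 0) \/
  forall k, h k <= (iter k step (loop 0 x v)).1.
Proof.
move=> xv; have [?|H] := pselect (exists k, (iter k step (loop 0 x v)).1 < 0); first by left.
right => k.
have {}H j : ~ (iter j step (loop 0 x v)).1 < 0 by move=> ?; apply: H; exists j.
suff [y [w [yw E]]] : exists y w, y ^+ 2 + w ^+ 2 = 1 /\
    iter k step (loop 0 x v) = loop k y w.
  have := H k; have := H k.+1; rewrite iterS E.
  by case: (loop_next k yw) => // -[].
elim: k => [|k [y [w [yw E]]]]; first by exists x, v.
have := H k; have := H k.+1; rewrite iterS E.
case: (loop_next k yw) => // -[_ [t Et]] _ _.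
by exists (cos t), (sin t); split=> //; exact: cos2Dsin2.
Qed.

(** * Undecided points lie on the loop *)

Definition undecided n p := forall k, ~ inside k n p /\ ~ outside k n p.

Lemma undecided_bounds n p : undecided n p ->
  [/\ h n ^+ 2 <= (p.1 - a) ^+ 2 + p.2 ^+ 2,
      (p.1 < a -> (p.1 - a) ^+ 2 + p.2 ^+ 2 <= h n ^+ 2),
      `|p.2| <= h n & (p.1 - a) ^+ 2 + p.2 ^+ 2 <= 5 * h n ^+ 2].
Proof.
move=> /(_ 0)[I O]; split.
- by rewrite leNgt; apply/negP => H; apply: I; left.
- by move=> pa; rewrite leNgt; apply/negP => H; apply: O; constructor 1.
- by rewrite leNgt; apply/negP => H; apply: O; constructor 2.
- by rewrite leNgt; apply/negP => H; apply: O; constructor 3.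
Qed.

Lemma undecided_step n p : undecided n p -> a < p.1 -> `|p.2| < h n ->
  undecided n.+1 (step p).
Proof.
move=> U pa ph k; have [I O] := U k.+1; split=> [H|H].
  by apply: I; right.
by apply: O; constructor 4.
Qed.

Lemma undecided_left n p : undecided n p -> p.1 <= a ->
  exists x v, [/\ x ^+ 2 + v ^+ 2 = 1, x <= 0 & p = loop n x v].
Proof.
move=> U pa; have [b1 b2 b3 _] := undecided_bounds U; have h0 := h_gt0 n.
have E : (p.1 - a) ^+ 2 + p.2 ^+ 2 = h n ^+ 2.
  apply/eqP; rewrite eq_le b1 andbT.
  (* The disc clause of [outside] requires Re p < a strictly; on the line Re p = a the bound |Im p|
     <= h_n replaces it. *)
  have [->|pNa] := eqVneq p.1 a; last by apply: b2; rewrite lt_neqAle pNa.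
  by rewrite subrr expr0n add0r -(real_normK (num_real p.2)) ler_pXn2r ?nnegrE ?(ltW h0).
have xv : ((p.1 - a) / h n) ^+ 2 + (p.2 / h n) ^+ 2 = 1.
  by rewrite !exprMn -mulrDl E exprVn divff// expf_neq0// gt_eqF.
have x0 : (p.1 - a) / h n <= 0 by rewrite pmulr_lle0 ?invr_gt0// subr_le0.
exists ((p.1 - a) / h n), (p.2 / h n); split=> //.
rewrite /loop; have [-> ->] := loop_left (adm n) xv x0.
rewrite !(mulrC (h n)) !mulfVK ?gt_eqF//.
by rewrite addrC subrK -surjective_pairing.
Qed.

(** Since cos h_n = -1, a point of these lines beyond Re = ln h_(n+1) is mapped to the left of a at
    distance more than h_(n+1), and is decided as outside after one step. What remains is the
    segment. *)
Lemma undecided_top n p : undecided n p -> a < p.1 -> `|p.2| = h n ->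
  exists2 v, -1 <= v <= 1 & p = (arcX (X n) n v, arcY (Y n) n v).
Proof.
move=> U pa ph; have h0 := h_gt0 n; have h1 := h_gt0 n.+1.
have /andP[r1 _] := ln_h_bound n; have ha1 := ha.
have c : cos p.2 = -1 by rewrite -cos_norm ph cos_h.
have s : sin p.2 = 0 by apply: cos1sin0; rewrite c normrN1.
have pr : p.1 <= ln (h n.+1).
  rewrite -ler_expR expR_ln_h leNgt; apply/negP => H.
  have [_] := U 1%N; apply; constructor 4; split=> //; constructor 1.
  rewrite step_modulus /= c mulrN1; split; first by have := expR_gt0 p.1; lra.
  by rewrite ltr_pXn2r ?nnegrE ?expR_ge0 ?(ltW h1).
set r := ln (h n.+1) in r1 pr *.
have ra : 0 < r - a by lra.
have [w [w1 w2 wE]] : exists w, [/\ 1/2 <= w, w <= 1 & r + (2 * w - 1) * (a - r) = p.1].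
  exists (((r - p.1) / (r - a) + 1) / 2).
  have q0 : 0 <= (r - p.1) / (r - a) by apply: divr_ge0; lra.
  have q1 : (r - p.1) / (r - a) <= 1 by rewrite ler_pdivrMr// mul1r; lra.
  split; [lra|lra|].
  by field; rewrite gt_eqF.
have [p20|p20] := leP 0 p.2.
  exists w; first by apply/andP; split; lra.
  have [-> ->] := arc_top (adm n) w1; rewrite -/r wE -ph ger0_norm//.
  by case: (p).
exists (- w); first by apply/andP; split; lra.
have [-> ->] := @arc_bot _ _ _ (adm n) (- w) ltac:(lra).
rewrite (_ : - (2 * - w) = 2 * w); last by ring.
by rewrite -/r wE -ph ltr0_norm// opprK -surjective_pairing.
Qed.

(** Pull back an approximation of f(p) on level n + 1. The error is measured in units of h_n because
    the induction ends on level n + k, where all that is known is that p and the curve lie within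
    sqrt 5 h_(n+k) of a. *)
Lemma undecided_approx k n p : undecided n p -> a < p.1 ->
  exists2 v, -1 <= v <= 1 &
    (arcX (X n) n v - p.1) ^+ 2 + (arcY (Y n) n v - p.2) ^+ 2
    <= (5 * h n / 2 ^+ k) ^+ 2.
Proof.
elim: k n p => [|k IH] n p U pa; have h0 := h_gt0 n; have h1 := h_gt0 n.+1.
  have zz : -1 <= (0 : R) <= 1 by apply/andP; split; lra.
  exists 0 => //; have [/andP[_ c1] _ _ _] := arc_bounds (adm n) zz.
  have [_ _ _ c2] := undecided_bounds U.
  rewrite expr0 divr1; move: c1 c2; move: (arcX _ _ _) (arcY _ _ _) => x y c1 c2.
  have e1 : (x - p.1) ^+ 2 <= 2 * (x - a) ^+ 2 + 2 * (p.1 - a) ^+ 2.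
    by have := sqr_ge0 ((x - a) + (p.1 - a)); nra.
  have e2 : (y - p.2) ^+ 2 <= 2 * y ^+ 2 + 2 * p.2 ^+ 2.
    by have := sqr_ge0 (y + p.2); nra.
  by have := sqr_ge0 (h n); nra.
have exact v : p = (arcX (X n) n v, arcY (Y n) n v) ->
    (arcX (X n) n v - p.1) ^+ 2 + (arcY (Y n) n v - p.2) ^+ 2 <= (5 * h n / 2 ^+ k.+1) ^+ 2.
  by move=> -> /=; rewrite !subrr expr0n addr0 sqr_ge0.
have [_ _ ph _] := undecided_bounds U.
move: ph; rewrite le_eqVlt => /orP[/eqP ph|ph].
  by have [v v1 /exact E] := undecided_top U pa ph; exists v.
have Us := undecided_step U pa ph.
have mid t : `|t| <= h n -> exists2 v, -1 <= v <= 1 &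
    arcX (X n) n v = X n t /\ arcY (Y n) n v = Y n t.
  move=> th; have v1 : `|t / (2 * h n)| <= 1 / 2.
    rewrite normrM normfV (ger0_norm (x := 2 * h n)) ?mulr_ge0 ?(ltW h0)//.
    by rewrite ler_pdivrMr ?mulr_gt0//; lra.
  exists (t / (2 * h n)).
    by move: v1; rewrite ler_norml => /andP[? ?]; apply/andP; split; lra.
  have [-> ->] := arc_mid (X n) (Y n) n v1.
  by rewrite (_ : h n * _ = t)//; field; rewrite gt_eqF.
have e0 := expR_gt0 p.1.
have rp : ln (h n.+1) <= p.1.
  rewrite -ler_expR expR_ln_h -(ler_pXn2r (ltn0Sn 1)) ?nnegrE ?expR_ge0 ?(ltW h1)//.
  by rewrite -step_modulus; have [] := undecided_bounds Us.
(* If f(p) is not to the right of a, it lies on the half circle; then p is on the line Re = ln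
   h_(n+1), on a part of gamma_n that is known exactly. *)
have [sa|sa] := leP (step p).1 a.
  have [x [v [xv x0 E]]] := undecided_left Us sa.
  have cp : cos p.2 <= 0 by move: sa; rewrite /exp_step /= -subr_ge0 => sa; nra.
  have er : p.1 = ln (h n.+1).
    apply: expR_inj; rewrite expR_ln_h; apply/eqP.
    rewrite -(eqrXn2 (n := 2)) ?expR_ge0 ?(ltW h1)//; apply/eqP.
    rewrite -step_modulus E /loop; have [-> ->] := loop_left (adm n.+1) xv x0.
    by rewrite /= -[RHS]mulr1 -xv; ring.
  have [v' v1' [Ex Ey]] := mid p.2 (ltW ph).
  exists v' => //; apply: exact; rewrite Ex Ey.
  by have [-> ->] := adm_left (adm n) cp; rewrite -er -surjective_pairing.
have [w w1 Hw] := IH _ _ Us sa.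
have cp : 0 < cos p.2 by move: sa; rewrite /exp_step /=; nra.
have [?|[m pm]] := cos_strip p.2; first lra.
(* This parameter lies in the strip of p and has sin t = w and cos t >= 0, so f maps the point of
   gamma_n at t to the approximating point at w. *)
have p0 := pi_gt0 R; pose t := 2 * pi * m%:~R + asin w.
have as1 := asin_geNpi2 w1; have as2 := asin_lepi2 w1.
have tm : `|t - 2 * pi * m%:~R| <= pi / 2.
  by rewrite /t ler_norml; apply/andP; split; lra.
have st : sin t = w by rewrite -(sin_2pi_int _ m) /t addrC addKr asinK// in_itv.
have ct : 0 <= cos t := cos_ge0_strip tm.
have th : `|t| <= h n.
  have [j hj] := h_odd n; move: ph pm tm.
  rewrite !ler_norml ltr_norml hj => /andP[q1 q2] /andP[q3 q4] /andP[q5 q6].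
  have mj : m <= j by apply: (@int_step _ _ _ (4/5)); lra.
  have mj' : - m <= j by apply: (@int_step _ _ _ (4/5)); rewrite ?mulrNz; lra.
  move: mj mj'; rewrite -!(ler_int R) mulrNz => mj mj'.
  have : 2 * pi * m%:~R <= 2 * pi * j%:~R :> R by rewrite ler_pM2l//; lra.
  have : 2 * pi * - m%:~R <= 2 * pi * j%:~R :> R by rewrite ler_pM2l//; lra.
  by move=> ? ?; apply/andP; split; lra.
have [v v1 [Ex Ey]] := mid t th; exists v => //; rewrite Ex Ey.
have /andP[xt _] := adm_bound (adm n) t.
have dy : `|Y n t - p.2| <= pi.
  have := adm_strip (adm n) tm; move: pm; rewrite !ler_norml.
  by move=> /andP[? ?] /andP[? ?]; apply/andP; split; lra.
have := exp_expand xt rp dy; rewrite expR_ln_h.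
have [L1 L2] : expR (X n t) * cos (Y n t) = arcX (X n.+1) n.+1 w - a /\
    expR (X n t) * sin (Y n t) = arcY (Y n.+1) n.+1 w.
  by have [_ _ _ /(_ t)] := XY n; rewrite /loopX /loopY ct st.
rewrite L1 L2.
rewrite (_ : arcX (X n.+1) n.+1 w - a - expR p.1 * cos p.2 =
  arcX (X n.+1) n.+1 w - (step p).1); last by rewrite /exp_step /=; ring.
move=> H; have {H Hw} := le_trans H Hw.
have := h_ge8 n; have k0 : 0 < 2 ^+ k :> R by rewrite exprn_gt0.
(* Dividing the error by the expansion h_(n+1) / 4 leaves 20 / 2^k, at most 5 h_n / 2^(k+1) because
   h_n >= 8. *)
have -> : (5 * h n.+1 / 2 ^+ k) ^+ 2 = h n.+1 ^+ 2 / 16 * (20 / 2 ^+ k) ^+ 2.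
  by field; rewrite gt_eqF.
rewrite ler_pM2l ?divr_gt0 ?exprn_gt0// => h8 H; apply: le_trans H _.
rewrite ler_pXn2r ?nnegrE ?divr_ge0 ?mulr_ge0 ?exprn_ge0 ?(ltW h0)//.
rewrite exprS invfM mulrA ler_wpM2r ?invr_ge0 ?(ltW k0)//; lra.
Qed.

(** To the right of a, approximation shows that p has distance 0 from the arc with its segments, and
    compactness of [-1, 1] makes the distance attained. *)
Lemma undecided_loop n p : undecided n p ->
  exists x v, x ^+ 2 + v ^+ 2 = 1 /\ p = loop n x v.
Proof.
move=> U; have [pa|pa] := leP p.1 a.
  by have [x [v [? _ ?]]] := undecided_left U pa; exists x, v.
have [cX cY _ _] := XY n.
pose D v : R := (arcX (X n) n v - p.1) ^+ 2 + (arcY (Y n) n v - p.2) ^+ 2.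
have cD : continuous D.
  move=> v; apply: cvgD.
    apply: (continuous_comp (f := fun v => arcX (X n) n v - p.1) (g := fun x => x ^+ 2)).
      by apply: cvgB; [exact: arcX_continuous|exact: cvg_cst].
    exact: exprn_continuous.
  apply: (continuous_comp (f := fun v => arcY (Y n) n v - p.2) (g := fun x => x ^+ 2)).
    by apply: cvgB; [exact: arcY_continuous|exact: cvg_cst].
  exact: exprn_continuous.
have [c cI minc] := @EVT_min R D (-1) 1 ltac:(lra) (continuous_subspaceT cD).
have D0 : D c <= 0.
  apply: (@le_approx R _ _ ((5 * h n) ^+ 2)) => k; rewrite add0r.
  have [v v1 Hv] := undecided_approx k U pa.
  apply: le_trans (minc v _) _; first by rewrite in_itv.
  apply: le_trans Hv _; rewrite exprMn ler_wpM2l ?sqr_ge0//.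
  have k0 : 0 < 2 ^+ k :> R by rewrite exprn_gt0.
  rewrite expr2 ler_piMl ?invr_ge0 ?(ltW k0)// invf_le1//.
  by rewrite exprn_ege1// ler1n.
have c1 : -1 <= c <= 1 by rewrite in_itv in cI.
exists (Num.sqrt (1 - c ^+ 2)), c.
have c2 : 0 <= 1 - c ^+ 2 by move: c1 => /andP[? ?]; nra.
split; first by rewrite sqr_sqrtr// subrK.
rewrite /loop /loopX /loopY sqrtr_ge0 [LHS]surjective_pairing.
have := sqr_ge0 (arcX (X n) n c - p.1); have := sqr_ge0 (arcY (Y n) n c - p.2).
move=> s1 s2; rewrite /D in D0.
have : (arcX (X n) n c - p.1) ^+ 2 = 0 by lra.
have : (arcY (Y n) n c - p.2) ^+ 2 = 0 by lra.
by move=> /eqP + /eqP; rewrite !sqrf_eq0 !subr_eq0 => /eqP -> /eqP ->.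
Qed.

(** * The separating curve *)

Definition loop_map (u : C) : C := pt (loop 0 (complex.Re u) (complex.Im u)).
Definition loop_curve : set C := loop_map @` @unit_circle R.

Lemma loop_map_continuous : {within @unit_circle R, continuous loop_map}.
Proof.
have [cX cY _ _] := XY 0.
have pasted (f g : C -> R) : continuous f -> continuous g ->
    (forall u, unit_circle u -> complex.Re u = 0 -> f u = g u) ->
    forall u, unit_circle u ->
    (if 0 <= complex.Re v then f v else g v) @[v --> within (@unit_circle R) (nbhs u)]
      --> (if 0 <= complex.Re u then f u else g u).
  move=> cf cg fg; apply/subspace_continuousP.
  by apply: paste_continuous => //; exact: continuous_Re.
have left u : unit_circle u -> complex.Re u = 0 ->
    arcX (X 0) 0 (complex.Im u) = a + h 0 * complex.Re u /\
    arcY (Y 0) 0 (complex.Im u) = h 0 * complex.Im u.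
  move=> /unit_circleE uc u0.
  have [] := loop_left (adm 0) uc; first by rewrite u0.
  by rewrite /loopX /loopY u0 lexx.
apply/subspace_continuousP => u uc; apply: cvg_pt.
- apply: (pasted (fun u => arcX (X 0) 0 (complex.Im u)) (fun u => a + h 0 * complex.Re u)) => //.
  + move=> w; apply: (@continuous_comp _ _ _ (@complex.Im R : C -> R)); first exact: continuous_Im.
    exact: arcX_continuous.
  + move=> w; have FF : Filter (nbhs w) := @nbhs_filter C w.
    by apply: cvgD; [exact: cvg_cst|apply: cvgMr; exact: continuous_Re].
  + by move=> w wc w0; have [] := left w wc w0.
- apply: (pasted (fun u => arcY (Y 0) 0 (complex.Im u)) (fun u => h 0 * complex.Im u)) => //.
  + move=> w; apply: (@continuous_comp _ _ _ (@complex.Im R : C -> R)); first exact: continuous_Im.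
    exact: arcY_continuous.
  + move=> w; have FF : Filter (nbhs w) := @nbhs_filter C w.
    by apply: cvgMr; exact: continuous_Im.
  + by move=> w wc w0; have [] := left w wc w0.
Qed.

Lemma loop_map_inj : {in @unit_circle R &, injective loop_map}.
Proof.
move=> u v; rewrite !inE => /unit_circleE uc /unit_circleE vc /(can_inj (@ptK R)) E.
have [] := loop_injective uc vc E.
by case: u v {uc vc E} => x y [x' y'] /= -> ->.
Qed.

Lemma loop_curve_simple : simple_closed_curve loop_curve.
Proof.
pose g (w : C) : C := if pselect (exists2 u, unit_circle u & loop_map u = w) is left e
  then projT1 (cid2 e) else 0.
have gK : {in @unit_circle R, cancel loop_map g}.
  move=> u; rewrite inE => uc; rewrite /g; case: pselect => [e|]; last by case; exists u.
  case: (cid2 e) => v vc E /=; apply: loop_map_inj => //; exact: mem_set.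
exists loop_map, g; split=> //.
- split; [by move=> u uc; exists u|exact: loop_map_inj|by []].
- exact: loop_map_continuous.
- apply: continuous_inverse_compact gK; [exact: norm_hausdorff|exact: compact_unit_circle|].
  exact: loop_map_continuous.
Qed.

Lemma loop_curve_sub : (forall n, n%:R <= h n) ->
  loop_curve `<=` fatou_set (exp_map (a%:C : C)) `|` escaping_set (exp_map (a%:C : C)).
Proof.
move=> hn _ [u /unit_circleE uc <-].
case: (loop_orbit uc) => [[k]|].
  by move=> H; left; apply: fatou_left H.
by move=> H; right; apply: escaping_of_Re hn H.
Qed.

Lemma loop_curve_separates (z : C) :
  (complex.Re z - a) ^+ 2 + complex.Im z ^+ 2 < h 0 ^+ 2 ->
  in_bounded_component (~` loop_curve) z.
Proof.
move=> zin.
pose I : set C := \bigcup_k [set w | inside k 0 (coord w)].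
pose O : set C := \bigcup_k [set w | outside k 0 (coord w)].
have oI : open I by apply: bigcup_open => k _; exact: open_inside.
have oO : open O by apply: bigcup_open => k _; exact: open_outside.
have zI : I z by exists 0%N => //; left.
have IO w : I w -> O w -> False.
  by move=> [k _ Ik] [j _ Oj]; apply: (inside_outside_disjoint Ik Oj).
have cover w : ~ loop_curve w -> I w \/ O w.
  move=> wl; apply: contrapT => /not_orP[wI wO]; apply: wl.
  have U : undecided 0 (coord w).
    by move=> k; split=> H; [apply: wI|apply: wO]; exists k.
  have [x [v [xv E]]] := undecided_loop U.
  by exists (pt (x, v)); [exact/unit_circleE|rewrite /loop_map /= -E coordK].
have zl : ~ loop_curve z.
  move=> [u /unit_circleE uc uz]; move: zin; rewrite -uz.
  have [/andP[lo _] _] := loop_bounds (adm 0) uc.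
  by move=> H; have := lt_le_trans H lo; rewrite ltxx.
split=> //.
have sub : connected_component (~` loop_curve) z `<=` I.
  move=> w [B [Bz BA Bc] Bw].
  (* Off the curve [I] is the complement of [O], hence relatively open and closed, and a connected
     set containing z stays in it. *)
  have BI : B `&` I = B.
    apply: Bc; first by exists z.
      by exists I.
    exists (~` O); first exact: open_closedC.
    apply/seteqP; split=> v [Bv]; first by move=> Iv; split=> // /(IO _ Iv).
    by move=> nO; split=> //; case: (cover v (BA _ Bv)).
  by move: Bw; rewrite -BI => -[].
(* By [inside_bound] both coordinates relative to a are at most sqrt 5 h_0 < 3 h_0 in modulus. *)
pose M : R := `|a| + 3 * h 0 + 3 * h 0.
exists (M%:C); split.
  by rewrite realE ler0c addr_ge0// ?addr_ge0// mulr_ge0// (le_trans _ (h_ge8 0)).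
move=> r Mr w /sub[k _ /inside_bound] /= H.
apply: le_trans (ltW Mr); rewrite (normc_def w) lecR.
have h0 := h_ge8 0.
have small (x : R) : x ^+ 2 <= 5 * h 0 ^+ 2 -> `|x| <= 3 * h 0.
  move=> Hx; rewrite -(ler_pXn2r (ltn0Sn 1)) ?nnegrE ?mulr_ge0//; last lra.
  by rewrite real_normK ?num_real//; nra.
have s1 := sqr_ge0 (complex.Re w - a); have s2 := sqr_ge0 (complex.Im w).
have hR := small (complex.Re w - a) ltac:(lra); have hI := small (complex.Im w) ltac:(lra).
have hR' : `|complex.Re w| <= `|a| + 3 * h 0.
  rewrite -[complex.Re w](subrK a); apply: le_trans (ler_normD _ _) _; lra.
have M0 : 0 <= M by rewrite /M; have := normr_ge0 a; lra.
rewrite -[leRHS]ger0_norm// -sqrtr_sqr ler_wsqrtr//.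
rewrite -(real_normK (num_real (complex.Re w))) -(real_normK (num_real (complex.Im w))).
have := normr_ge0 (complex.Re w); have := normr_ge0 (complex.Im w); rewrite /M; nra.
Qed.

End Sequence.
End Curves.

Theorem theorem1p3 (R : realType) (a : R) (ha : a <= -1) (z : R[i]^o) :
  exists beta : set R[i]^o,
    [/\ simple_closed_curve beta,
        beta `<=` fatou_set (exp_map a%:C) `|` escaping_set (exp_map a%:C)
      & in_bounded_component (~` beta) z].
Proof.
pose d := Num.sqrt ((complex.Re z - a) ^+ 2 + complex.Im z ^+ 2).
have d0 : 0 <= d by rewrite sqrtr_ge0.
(* As a <= -1 and d >= 0, this threshold exceeds 8, 3 - a and d; the last puts z into the disc of
   radius h_0 about a, which is inside at stage 0. *)
have [h [h_odd hx h_grow hn]] := @levels_exist R (9 - a + d) ltac:(lra).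
have h_ge8 n : 8 <= h n by have := hx n; lra.
have h_gea n : 3 - a <= h n by have := hx n; lra.
have [X [Y XY]] := curves_exist ha h_odd h_ge8 h_gea h_grow.
exists (loop_curve a h X Y); split.
- exact: loop_curve_simple.
- exact: loop_curve_sub.
- apply: loop_curve_separates => //.
  have dE : d ^+ 2 = (complex.Re z - a) ^+ 2 + complex.Im z ^+ 2.
    by rewrite sqr_sqrtr// addr_ge0 ?sqr_ge0.
  by rewrite -dE ltr_pXn2r ?nnegrE//; have := hx 0%N; lra.
Qed.
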